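(* The Fourier transform $\mathcal{F}$, $\mathcal{F}[\varphi](\xi)=\widehat{\varphi}(\xi)=\int_{\mathbb{A}_f}\varphi(x)\chi(\xi x)\,dx$ ($\xi\in\mathbb{A}_f$), is a continuous linear isomorphism from the space $\mathcal{D}(\mathbb{A}_f)$ onto itself, and the inversion formula holds: $$\varphi(x)=\int_{\mathbb{A}_f}\chi(\xi x)\,\widehat{\varphi}(-\xi)\,d\xi\qquad(\varphi\in\mathcal{D}(\mathbb{A}_f),\ x\in\mathbb{A}_f).$$ Additionally, the Parseval–Steklov equality holds: for all $\varphi,\psi\in\mathcal{D}(\mathbb{A}_f)$, $$\int_{\mathbb{A}_f}\varphi(x)\overline{\psi(x)}\,dx=\int_{\mathbb{A}_f}\widehat{\varphi}(\xi)\overline{\widehat{\psi}(\xi)}\,d\xi.$$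
   Context: $\mathbb{A}_f$ is the ring of finite adèles of $\mathbb{Q}$ and $\widehat{\mathbb{Z}}=\prod_p\mathbb{Z}_p\subset\mathbb{A}_f$ its maximal compact open subring; $dx$ is the Haar measure on $\mathbb{A}_f$ giving $\widehat{\mathbb{Z}}$ mass one. For $x\in\mathbb{A}_f$, the fractional part $\{x\}$ is the unique rational number in $[0,1)$ with $x-\{x\}\in\widehat{\mathbb{Z}}$, and $\chi(x)=\exp(2\pi i\{x\})$ is the canonical additive character. Let $1=m_0<m_1<m_2<\cdots$ be the increasing enumeration of the distinct values of $\mathrm{lcm}(1,\dots,N)$, $N\ge1$; set $e^{\psi(n)}=m_n$ for $n\ge0$, $e^{\psi(n)}=1/m_{-n}$ for $n<0$ (this arithmetical $\psi$ is unrelated to the test function $\psi$ in the claim), and $\mathfrak{a}^n=e^{-\psi(n)}\widehat{\mathbb{Z}}$ for $n\in\mathbb{Z}$ (an increasing family of compact open subgroups). For integers $\ell\le k$, $\mathcal{D}^\ell_k(\mathbb{A}_f)$ is the finite-dimensional complex vector space of functions $\varphi:\mathbb{A}_f\to\mathbb{C}$ supported in $\mathfrak{a}^k$ with $\varphi(x+y)=\varphi(x)$ for all $x\in\mathbb{A}_f$, $y\in\mathfrak{a}^\ell$. The Bruhat–Schwartz space $\mathcal{D}(\mathbb{A}_f)$ is the space of locally constant compactly supported functions $\mathbb{A}_f\to\mathbb{C}$; it is the union of the spaces $\mathcal{D}^\ell_k(\mathbb{A}_f)$ and carries the corresponding locally convex inductive limit topology. *)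

(* Defs.v *)
From HB Require Import structures.
From mathcomp Require Import all_boot all_order all_algebra.
From mathcomp Require Import ring_quotient generic_quotient.
From mathcomp Require Import all_classical all_reals all_analysis.
From mathcomp Require Import complex.

Set Implicit Arguments.
Unset Strict Implicit.
Unset Printing Implicit Defensive.

Import Order.TTheory GRing.Theory Num.Theory.
Local Open Scope classical_set_scope.
Local Open Scope ring_scope.

Definition prime_nat := {p : nat | prime p}.

Definition padic_norm (p : nat) (q : rat) : rat :=
  if q == 0 then 0
  else p%:R ^+ logn p `|denq q|%N / p%:R ^+ logn p `|numq q|%N.

Section PadicNorm.
Variables (p : nat) (p_pr : prime p).

Local Notation nrm := (padic_norm p).

Let p_gt0 : (0 : rat) < p%:R. Proof. by rewrite ltr0n prime_gt0. Qed.
Let p_neq0 : (p%:R : rat) != 0. Proof. by rewrite pnatr_eq0 -lt0n prime_gt0. Qed.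
Let p_ge1 : (1 : rat) <= p%:R. Proof. by rewrite ler1n prime_gt0. Qed.

Lemma padic_norm0 : nrm 0 = 0. Proof. by rewrite /padic_norm eqxx. Qed.

Lemma padic_normE (a b : int) : a != 0 -> b != 0 ->
  nrm (a%:~R / b%:~R) = p%:R ^+ logn p `|b|%N / p%:R ^+ logn p `|a|%N.
Proof.
move=> a0 b0; set q : rat := a%:~R / b%:~R.
have q0 : q != 0 by rewrite /q mulf_eq0 invr_eq0 !intr_eq0 negb_or a0.
rewrite /padic_norm (negPf q0).
have nq0 : numq q != 0 by rewrite numq_eq0.
have e : (a * denq q = numq q * b)%R.
  apply: (@intr_inj rat); rewrite !rmorphM /=.
  have := divq_num_den q; rewrite {2}/q => /eqP.
  by rewrite eqr_div ?intr_eq0 ?denq_neq0 // => /eqP ->; rewrite mulrC.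
have := congr1 (fun z : int => logn p `|z|%N) e.
rewrite !abszM !lognM ?absz_gt0 ?denq_neq0 // => e'.
apply/eqP; rewrite eqr_div ?expf_neq0 // -!exprD; apply/eqP; congr (_ ^+ _).
by rewrite addnC e' addnC.
Qed.

Lemma padic_norm_ge0 x : 0 <= nrm x.
Proof.
rewrite /padic_norm; case: ifP => // _.
Qed.

Lemma padic_normM x y : nrm (x * y) = nrm x * nrm y.
Proof.
have [->|x0] := eqVneq x 0; first by rewrite mul0r padic_norm0 mul0r.
have [->|y0] := eqVneq y 0; first by rewrite mulr0 padic_norm0 mulr0.
have -> : x * y = (numq x * numq y)%:~R / (denq x * denq y)%:~R.
  rewrite -{1}(divq_num_den x) -{1}(divq_num_den y) !rmorphM /=.
  by rewrite mulf_div.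
rewrite padic_normE ?mulf_neq0 ?numq_eq0 ?denq_neq0 //.
rewrite !abszM !lognM ?absz_gt0 ?numq_eq0 ?denq_neq0 // !exprD.
by rewrite /padic_norm (negPf x0) (negPf y0) mulf_div.
Qed.

Lemma padic_norm1 : nrm 1 = 1.
Proof.
by rewrite -[1 in LHS]divr1 (@padic_normE 1 1) //= logn1 expr0 divr1.
Qed.

Lemma padic_normN x : nrm (- x) = nrm x.
Proof. by rewrite /padic_norm oppr_eq0 numqN denqN abszN. Qed.

Lemma padic_normD x y : nrm (x + y) <= Num.max (nrm x) (nrm y).
Proof.
have [->|x0] := eqVneq x 0; first by rewrite add0r le_max lexx orbT.
have [->|y0] := eqVneq y 0; first by rewrite addr0 le_max lexx.
have [->|xy0] := eqVneq (x + y) 0.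
  by rewrite padic_norm0 le_max padic_norm_ge0.
set a := numq x * denq y; set b := numq y * denq x; set d := denq x * denq y.
have d0 : d != 0 by rewrite mulf_neq0 ?denq_neq0.
have a0 : a != 0 by rewrite mulf_neq0 ?denq_neq0 ?numq_eq0.
have b0 : b != 0 by rewrite mulf_neq0 ?denq_neq0 ?numq_eq0.
have ex : x = a%:~R / d%:~R.
  rewrite -[LHS]divq_num_den /a /d !rmorphM /=.
  by rewrite -mulf_div divff ?mulr1 // intr_eq0 denq_neq0.
have ey : y = b%:~R / d%:~R.
  rewrite -[LHS]divq_num_den /b /d !rmorphM /= [_ * (denq y)%:~R]mulrC.
  by rewrite -mulf_div divff ?mulr1 // intr_eq0 denq_neq0.
have exy : x + y = (a + b)%:~R / d%:~R by rewrite ex ey rmorphD mulrDl.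
have ab0 : a + b != 0.
  by apply: contra_neq xy0 => h; rewrite exy h mul0r.
rewrite exy ex ey !padic_normE //.
set k := minn (logn p `|a|%N) (logn p `|b|%N).
have dvdab : (p ^ k %| `|(a + b)%R|)%N.
  have da : ((p ^ k)%N%:Z %| a)%Z.
    have : (p ^ k %| `|a|)%N by rewrite pfactor_dvdn ?absz_gt0 // geq_minl.
    by [].
  have db : ((p ^ k)%N%:Z %| b)%Z.
    have : (p ^ k %| `|b|)%N by rewrite pfactor_dvdn ?absz_gt0 // geq_minr.
    by [].
  by have := rpredD da db.
have kl : (k <= logn p `|(a + b)%R|%N)%N by rewrite -pfactor_dvdn ?absz_gt0.
have main : p%:R ^+ logn p `|d|%N / p%:R ^+ logn p `|(a + b)%R|%N <=
            p%:R ^+ logn p `|d|%N / (p%:R ^+ k : rat).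
  rewrite ler_pM2l ?exprn_gt0 // lef_pV2 ?posrE ?exprn_gt0 //.
  by rewrite ler_weXn2l.
apply: le_trans main _; rewrite le_max /k.
by case: leqP => _; rewrite lexx ?orbT.
Qed.

Lemma padic_normB x y : nrm (x - y) <= Num.max (nrm x) (nrm y).
Proof. by rewrite -(padic_normN y) padic_normD. Qed.

End PadicNorm.

(* Q_p is the completion of the rationals for the p-adic absolute value: the
   ring of Cauchy sequences modulo the ideal of null sequences. *)

Section Padic.
Variable p : prime_nat.

Local Notation nrm := (padic_norm (val p)).
Let p_pr : prime (val p) := valP p.

Definition padic_cauchy (u : nat -> rat) : Prop :=
  forall e : rat, 0 < e ->
    exists N, forall m n, (N <= m)%N -> (N <= n)%N -> nrm (u m - u n) < e.

Definition padic_null (u : nat -> rat) : Prop :=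
  forall e : rat, 0 < e -> exists N, forall n, (N <= n)%N -> nrm (u n) < e.

Definition padic_cauchy_pred : pred (nat -> rat) := fun u => `[< padic_cauchy u >].

Lemma padic_cauchy_bounded u : padic_cauchy u ->
  exists2 M : rat, 0 < M & forall n, nrm (u n) <= M.
Proof.
move=> /(_ 1 ltr01)[N HN].
have [M M0 HM] : exists2 M : rat, 0 < M &
    forall n, (n <= N)%N -> nrm (u n) <= M.
  elim: N {HN} => [|N [M M0 HM]].
    exists (nrm (u 0%N) + 1); first by rewrite ltr_wpDl ?padic_norm_ge0.
    by move=> n; rewrite leqn0 => /eqP ->; rewrite lerDl.
  exists (M + nrm (u N.+1)); first by rewrite ltr_wpDr ?padic_norm_ge0.
  move=> n; rewrite leq_eqVlt ltnS => /predU1P[->|/HM h].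
    by rewrite lerDr ltW.
  by rewrite (le_trans h) // lerDl padic_norm_ge0.
exists (M + 1) => [|n]; first by rewrite ltr_wpDr.
have [nN|/ltnW Nn] := leqP n N; first by rewrite (le_trans (HM _ nN)) ?lerDl.
rewrite -(subrK (u N) (u n)) (le_trans (padic_normD _ _ _)) //.
rewrite ge_max (le_trans (ltW (HN _ _ Nn (leqnn _)))) ?lerDr ?(ltW M0) //=.
by rewrite (le_trans (HM _ (leqnn _))) ?lerDl.
Qed.

Fact padic_cauchy_subring : subring_closed padic_cauchy_pred.
Proof.
split.
- apply/asboolP => e e0; exists 0%N => m n _ _ /=.
  by rewrite subrr padic_norm0.
- move=> u v /asboolP cu /asboolP cv; apply/asboolP => e e0.
  have [N1 H1] := cu e e0; have [N2 H2] := cv e e0.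
  exists (maxn N1 N2) => m n; rewrite !geq_max => /andP[m1 m2] /andP[n1 n2].
  have -> : (u - v) m - (u - v) n = (u m - u n) - (v m - v n).
    by rewrite !opprD !opprK addrACA.
  apply: le_lt_trans (padic_normB p_pr _ _) _.
  by rewrite gt_max H1 // H2.
- move=> u v /asboolP cu /asboolP cv; apply/asboolP => e e0.
  have [A A0 HA] := padic_cauchy_bounded cu.
  have [B B0 HB] := padic_cauchy_bounded cv.
  have [N1 H1] := cu (e / B) (divr_gt0 e0 B0).
  have [N2 H2] := cv (e / A) (divr_gt0 e0 A0).
  exists (maxn N1 N2) => m n; rewrite !geq_max => /andP[m1 m2] /andP[n1 n2].
  have -> : (u * v) m - (u * v) n = (u m - u n) * v m + u n * (v m - v n).
    by rewrite mulrBl mulrBr addrA subrK.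
  apply: le_lt_trans (padic_normD p_pr _ _) _.
  rewrite !padic_normM // gt_max; apply/andP; split.
      apply: (@le_lt_trans _ _ (nrm (u m - u n) * B)).
    by rewrite ler_wpM2l ?padic_norm_ge0.
    by rewrite -ltr_pdivlMr // H1.
  apply: (@le_lt_trans _ _ (A * nrm (v m - v n))).
    by rewrite ler_wpM2r ?padic_norm_ge0.
  by rewrite mulrC -ltr_pdivlMr // H2.
Qed.

HB.instance Definition _ :=
  GRing.isSubringClosed.Build (nat -> rat) padic_cauchy_pred padic_cauchy_subring.

Record padic_seq := PadicSeq {
  padic_seq_val :> nat -> rat;
  _ : padic_seq_val \in padic_cauchy_pred }.

HB.instance Definition _ := [isSub for padic_seq_val].
HB.instance Definition _ := [Choice of padic_seq by <:].
HB.instance Definition _ := [SubChoice_isSubComNzRing of padic_seq by <:].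

Definition padic_null_pred : pred padic_seq := fun u => `[< padic_null u >].

Fact padic_null_ideal : idealr_closed padic_null_pred.
Proof.
split.
- by apply/asboolP => e e0; exists 0%N => n _; rewrite padic_norm0.
- apply/negP => /asboolP /(_ 1 ltr01) [N /(_ N (leqnn _))].
  by rewrite padic_norm1 // ltxx.
- move=> a u v /asboolP nu /asboolP nv; apply/asboolP => e e0.
  have [A A0 HA] := padic_cauchy_bounded (asboolW (valP a)).
  have [N1 H1] := nu (e / A) (divr_gt0 e0 A0).
  have [N2 H2] := nv e e0.
  exists (maxn N1 N2) => n; rewrite geq_max => /andP[n1 n2].
  apply: le_lt_trans (padic_normD p_pr _ _) _.
  rewrite gt_max H2 // andbT padic_normM //.
  apply: (@le_lt_trans _ _ (A * nrm (u n))).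
    by rewrite ler_wpM2r ?padic_norm_ge0.
  by rewrite mulrC -ltr_pdivlMr // H1.
Qed.

HB.instance Definition _ := isIdealr.Build padic_seq padic_null_pred padic_null_ideal.

Definition padic := {ideal_quot (padic_null_pred : idealr padic_seq)}.
HB.instance Definition _ := GRing.ComNzRing.on padic.

Fact padic_const_subproof (q : rat) : cst q \in padic_cauchy_pred.
Proof.
by apply/asboolP => e e0; exists 0%N => m n _ _; rewrite subrr padic_norm0.
Qed.

Definition padic_of_seq (u : padic_seq) : padic := \pi_(padic)%qT u.

Definition padic_of_rat (q : rat) : padic :=
  padic_of_seq (PadicSeq (padic_const_subproof q)).

(* Z_p, as the set of limits of rationals of p-adic absolute value <= 1. *)
Definition padic_int : set padic :=
  [set x | exists2 u : padic_seq, x = padic_of_seq u & forall n, nrm (u n) <= 1].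

Lemma padic_of_seqB u v : padic_of_seq (u - v) = padic_of_seq u - padic_of_seq v.
Proof. exact: rmorphB. Qed.

Lemma padic_of_seqM u v : padic_of_seq (u * v) = padic_of_seq u * padic_of_seq v.
Proof. exact: rmorphM. Qed.

Lemma padic_int1 : padic_int 1.
Proof. by exists 1 => [|n]; rewrite ?padic_norm1 //; apply/esym; exact: rmorph1. Qed.

Lemma padic_intB x y : padic_int x -> padic_int y -> padic_int (x - y).
Proof.
move=> [u -> hu] [v -> hv]; exists (u - v); first by rewrite padic_of_seqB.
move=> n; apply: le_trans (padic_normB p_pr _ _) _.
by rewrite ge_max hu hv.
Qed.

Lemma padic_intM x y : padic_int x -> padic_int y -> padic_int (x * y).
Proof.
move=> [u -> hu] [v -> hv]; exists (u * v); first by rewrite padic_of_seqM.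
move=> n; rewrite [X in nrm X](_ : _ = u n * v n) // padic_normM //.
by rewrite mulr_ile1 ?padic_norm_ge0.
Qed.

Lemma padic_int0 : padic_int 0.
Proof. by rewrite -(subrr 1); apply: padic_intB; apply: padic_int1. Qed.

Lemma padic_intN x : padic_int x -> padic_int (- x).
Proof. by move=> hx; rewrite -sub0r; apply: padic_intB => //; apply: padic_int0. Qed.

Lemma padic_intD x y : padic_int x -> padic_int y -> padic_int (x + y).
Proof. by move=> hx hy; rewrite -(opprK y); apply: padic_intB => //; apply: padic_intN. Qed.

Definition padic_ball (x : padic) (n : nat) : set padic :=
  [set x + (val p)%:R ^+ n * z | z in padic_int].

Definition padic_balls : set (set padic) := [set padic_ball x n | x in setT & n in setT].

Lemma padic_int_nat n : padic_int n%:R.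
Proof.
elim: n => [|n ih]; first exact: padic_int0.
by rewrite -addn1 natrD; apply: padic_intD => //; apply: padic_int1.
Qed.

Lemma padic_intX x n : padic_int x -> padic_int (x ^+ n).
Proof.
move=> hx; elim: n => [|n ih]; first exact: padic_int1.
by rewrite exprS; apply: padic_intM.
Qed.

Lemma padic_ball_center x n : padic_ball x n x.
Proof. by exists 0; [exact: padic_int0|rewrite mulr0 addr0]. Qed.

Lemma padic_ball_sub x y k n : padic_ball x k y -> (k <= n)%N ->
  padic_ball y n `<=` padic_ball x k.
Proof.
move=> [z iz <-] kn _ [w iw <-].
exists (z + (val p)%:R ^+ (n - k) * w).
  apply: padic_intD => //; apply: padic_intM => //.
  by apply: padic_intX; apply: padic_int_nat.
by rewrite mulrDr mulrA -exprD subnKC // addrA.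
Qed.

Fact padic_balls_cover : \bigcup_(B in padic_balls) id B = setT.
Proof.
apply/seteqP; split => // x _; exists (padic_ball x 0).
  by exists x => //; exists 0%N.
exact: padic_ball_center.
Qed.

Fact padic_balls_join (A B : set padic) t : padic_balls A -> padic_balls B ->
  id A t -> id B t -> exists C, [/\ padic_balls C, id C t & id C `<=` id A `&` id B].
Proof.
move=> [x _ [k _ <-]] [y _ [n _ <-]] /= xt yt.
exists (padic_ball t (maxn k n)); split.
- by exists t => //; exists (maxn k n).
- exact: padic_ball_center.
- move=> z tz; split.
    exact: (padic_ball_sub xt (leq_maxl k n) tz).
  exact: (padic_ball_sub yt (leq_maxr k n) tz).
Qed.

HB.instance Definition _ :=
  isBaseTopological.Build padic padic_balls_cover padic_balls_join.

Lemma open_padic_int : open padic_int.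
Proof.
rewrite openE => x ix; exists (padic_ball x 0); split => /=.
- exists [set padic_ball x 0].
    by move=> _ ->; exists x => //; exists 0%N.
  by rewrite bigcup_set1.
- exact: padic_ball_center.
- move=> _ [z iz <-]; rewrite expr0 mul1r.
  exact: padic_intD.
Qed.

End Padic.

(* The finite adeles form the restricted product of the Q_p with respect to the
   Z_p: the families all but finitely many of whose members are integral. *)

Definition padic_family := forall p : prime_nat, padic p.

HB.instance Definition _ := gen_eqMixin padic_family.
HB.instance Definition _ := gen_choiceMixin padic_family.

Section FamilyRing.
Implicit Types x y z : padic_family.

Definition fam_zero : padic_family := fun=> 0.
Definition fam_one : padic_family := fun=> 1.
Definition fam_opp x : padic_family := fun p => - x p.
Definition fam_add x y : padic_family := fun p => x p + y p.
Definition fam_mul x y : padic_family := fun p => x p * y p.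

Fact fam_addA : associative fam_add.
Proof. by move=> x y z; apply: functional_extensionality_dep => p; exact: addrA. Qed.
Fact fam_addC : commutative fam_add.
Proof. by move=> x y; apply: functional_extensionality_dep => p; exact: addrC. Qed.
Fact fam_add0 : left_id fam_zero fam_add.
Proof. by move=> x; apply: functional_extensionality_dep => p; exact: add0r. Qed.
Fact fam_addN : left_inverse fam_zero fam_opp fam_add.
Proof. by move=> x; apply: functional_extensionality_dep => p; exact: addNr. Qed.
HB.instance Definition _ :=
  GRing.isZmodule.Build padic_family fam_addA fam_addC fam_add0 fam_addN.

Fact fam_mulA : associative fam_mul.
Proof. by move=> x y z; apply: functional_extensionality_dep => p; exact: mulrA. Qed.
Fact fam_mulC : commutative fam_mul.
Proof. by move=> x y; apply: functional_extensionality_dep => p; exact: mulrC. Qed.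
Fact fam_mul1 : left_id fam_one fam_mul.
Proof. by move=> x; apply: functional_extensionality_dep => p; exact: mul1r. Qed.
Fact fam_mulDl : left_distributive fam_mul fam_add.
Proof. by move=> x y z; apply: functional_extensionality_dep => p; exact: mulrDl. Qed.
Fact fam_one_neq0 : fam_one != fam_zero.
Proof.
apply/eqP => /(congr1 (fun f : padic_family => f (exist _ 2 isT))) /eqP.
by rewrite /fam_one /fam_zero oner_eq0.
Qed.
HB.instance Definition _ := GRing.Zmodule_isComNzRing.Build padic_family
  fam_mulA fam_mulC fam_mul1 fam_mulDl fam_one_neq0.

End FamilyRing.

Definition adelic_pred : pred padic_family :=
  fun x => `[< finite_set [set p | ~ padic_int (x p)] >].

Fact adelic_subring : subring_closed adelic_pred.
Proof.
split.
- apply/asboolP; rewrite [X in finite_set X](_ : _ = set0) //.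
  by apply/seteqP; split => // p /= []; exact: padic_int1.
- move=> x y /asboolP fx /asboolP fy; apply/asboolP.
  have : finite_set ([set p | ~ padic_int (x p)] `|` [set p | ~ padic_int (y p)]).
    by rewrite finite_setU.
  apply: sub_finite_set => p /= h; apply: contrapT => /not_orP[/contrapT ix /contrapT iy].
  by apply: h; exact: padic_intB.
- move=> x y /asboolP fx /asboolP fy; apply/asboolP.
  have : finite_set ([set p | ~ padic_int (x p)] `|` [set p | ~ padic_int (y p)]).
    by rewrite finite_setU.
  apply: sub_finite_set => p /= h; apply: contrapT => /not_orP[/contrapT ix /contrapT iy].
  by apply: h; exact: padic_intM.
Qed.
HB.instance Definition _ :=
  GRing.isSubringClosed.Build padic_family adelic_pred adelic_subring.

Record adele := Adele { adele_val : padic_family; _ : adele_val \in adelic_pred }.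

Definition adele_coord (x : adele) : forall p : prime_nat, padic p := adele_val x.
Coercion adele_coord : adele >-> Funclass.

HB.instance Definition _ := [isSub for adele_val].
HB.instance Definition _ := [Choice of adele by <:].
HB.instance Definition _ := [SubChoice_isSubComNzRing of adele by <:].
HB.instance Definition _ := isPointed.Build adele 0.

Definition Zhat : set adele := [set x : adele | forall p, padic_int (x p)].

(* A base of the restricted product topology: the products of open sets U p
   with U p = Z_p for all but finitely many p. *)

Definition adele_box (U : forall p : prime_nat, set (padic p)) : set adele :=
  [set x : adele | forall p, U p (x p)].

Definition adele_boxes : set (set adele) :=
  [set adele_box U | U in
    [set U | (forall p, open (U p)) /\ finite_set [set p | U p <> @padic_int p]]].

Fact adele_boxes_cover : \bigcup_(B in adele_boxes) id B = setT.
Proof.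
apply/seteqP; split => // x _.
pose U p : set (padic p) := if `[< padic_int (x p) >] then @padic_int p else setT.
exists (adele_box U).
  exists U => //; split => [p|].
    by rewrite /U; case: ifP => _; [exact: open_padic_int|exact: openT].
  have /asboolP := valP x; apply: sub_finite_set => p /= h ix.
  by apply: h; rewrite /U (asboolT ix).
by move=> p; rewrite /U; case: asboolP.
Qed.

Fact adele_boxes_join (A B : set adele) t : adele_boxes A -> adele_boxes B ->
  id A t -> id B t -> exists C, [/\ adele_boxes C, id C t & id C `<=` id A `&` id B].
Proof.
move=> [U [oU fU] <-] [V [oV fV] <-] /= Ut Vt.
exists (adele_box (fun p => U p `&` V p)); split => //.
- exists (fun p => U p `&` V p) => //; split => [p|]; first exact: openI.
  have : finite_set ([set p | U p <> @padic_int p] `|` [set p | V p <> @padic_int p]).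
    by rewrite finite_setU.
  apply: sub_finite_set => p /= h; apply: contrapT => /not_orP[/contrapT uE /contrapT vE].
  by apply: h; rewrite uE vE setIid.
- by move=> x h; split => p; have [] := h p.
Qed.

HB.instance Definition _ :=
  isBaseTopological.Build adele adele_boxes_cover adele_boxes_join.

Fact adele_of_rat_subproof (q : rat) :
  (fun p : prime_nat => padic_of_rat p q) \in adelic_pred.
Proof.
apply/asboolP.
apply: (@sub_finite_set _ _ (val @^-1` [set` primes `|denq q|%N])); last first.
  by apply: finite_preimage => [? ? _ _|]; [exact: val_inj|exact: finite_seq].
move=> p /= h; rewrite mem_primes (valP p) absz_gt0 denq_neq0 /=.
apply: contrapT => /negP npd; apply: h.
exists (PadicSeq (padic_const_subproof p q)) => // _ /=.
rewrite /padic_norm; case: ifP => // _.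
rewrite logn_coprime ?prime_coprime ?(valP p) // expr0 div1r.
have pge1 : (1 : rat) <= (val p)%:R by rewrite ler1n prime_gt0 ?(valP p).
by rewrite invf_le1 ?exprn_ege1 // exprn_gt0 // (lt_le_trans ltr01).
Qed.

Definition adele_of_rat (q : rat) : adele := Adele (adele_of_rat_subproof q).

(* Exactly one rational meets the condition, so the default value 0 of [xget]
   is never used. *)
Definition frac_part (x : adele) : rat :=
  xget 0 [set q : rat | 0 <= q < 1 /\ Zhat (x - adele_of_rat q)].

Section Character.
Variable R : realType.
Local Open Scope complex_scope.

Definition cexp (z : R[i]) : R[i] :=
  (expR (complex.Re z))%:C * (cos (complex.Im z) +i* sin (complex.Im z)).

Definition chi (x : adele) : R[i] :=
  cexp (2 * pi%:C * 'i * (ratr (frac_part x))%:C).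

End Character.

Definition lcm_upto (N : nat) : nat := \big[lcmn/1]_(1 <= i < N.+1) i.

Lemma lcm_upto_le m n : (m <= n)%N -> (lcm_upto m <= lcm_upto n)%N.
Proof.
move=> mn; have pos N : (0 < lcm_upto N)%N.
  rewrite /lcm_upto big_nat; elim/big_ind: _ => // [x y x0 y0|i /andP[]//].
  by rewrite lcmn_gt0 x0.
apply: dvdn_leq => //; rewrite /lcm_upto [in X in (_ %| X)%N](@big_cat_nat _ _ _ m.+1) //=.
exact: dvdn_lcml.
Qed.

Lemma lcm_upto_unbounded (v : nat) : exists N, (v < lcm_upto N)%N.
Proof.
exists v.+1; apply: dvdn_leq; last first.
  by rewrite /lcm_upto big_nat_recr //= dvdn_lcmr.
rewrite /lcm_upto big_nat; elim/big_ind: _ => // [x y x0 y0|i /andP[]//].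
by rewrite lcmn_gt0 x0.
Qed.

(* As [lcm_upto] is nondecreasing, its value at the least N where it exceeds v
   is its least value exceeding v. *)
Definition next_lcm (v : nat) : nat := lcm_upto (ex_minn (lcm_upto_unbounded v)).

(* The enumeration m_n; see [lcm_value_increasing] and [lcm_value_range]. *)
Definition lcm_value (n : nat) : nat := iter n next_lcm 1.

Lemma lcm_value_increasing n : (lcm_value n < lcm_value n.+1)%N.
Proof.
rewrite -[lcm_value n.+1]/(next_lcm (lcm_value n)) /next_lcm.
by case: ex_minnP.
Qed.

Lemma lcm_value_range : range lcm_value = lcm_upto @` [set N | (1 <= N)%N].
Proof.
have l1 : lcm_upto 1 = 1%N by rewrite /lcm_upto big_nat1.
apply/seteqP; split=> [_ [n _ <-]|_ [N /= N1 <-]].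
  case: n => [|n]; first by exists 1%N.
  rewrite -[lcm_value n.+1]/(next_lcm (lcm_value n)) /next_lcm.
  case: ex_minnP => -[_ _|N _ _]; last by exists N.+1.
  by exists 1%N; rewrite // l1 /lcm_upto big_geq.
have [n] : exists n, (lcm_upto N < lcm_value n)%N.
  exists (lcm_upto N).+1; elim: (lcm_upto N).+1 => // k h.
  exact: leq_ltn_trans h (lcm_value_increasing k).
elim: n => [|n IH].
  by rewrite ltnNge -[lcm_value 0]l1 lcm_upto_le.
have [/IH//|] := ltnP (lcm_upto N) (lcm_value n).
rewrite leq_eqVlt => /predU1P[e|lt]; first by exists n.
rewrite -[lcm_value n.+1]/(next_lcm (lcm_value n)) /next_lcm.
case: ex_minnP => M _ /(_ N lt) /lcm_upto_le.
by rewrite leqNgt => /negP.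
Qed.

(* The number e^psi(n), with psi the arithmetical function of the filtration. *)
Definition expsi (n : int) : rat :=
  match n with
  | Posz k => (lcm_value k)%:R
  | Negz k => (lcm_value k.+1)%:R^-1
  end.

(* The compact open subgroup a^n. *)
Definition lattice (n : int) : set adele :=
  [set adele_of_rat (expsi n)^-1 * z | z in Zhat].

Section BruhatSchwartz.
Variable R : realType.
Local Open Scope complex_scope.

Definition locally_constant (f : adele -> R[i]) : Prop :=
  forall x, \forall y \near x, f y = f x.

Definition compactly_supported (f : adele -> R[i]) : Prop :=
  compact (closure [set x | f x != 0]).

Definition bruhat_schwartz_pred : pred (adele -> R[i]) :=
  fun f => `[< locally_constant f /\ compactly_supported f >].

Fact bruhat_schwartz_submod : GRing.submod_closed bruhat_schwartz_pred.
Proof.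
split.
  apply/asboolP; split; first by move=> x; near=> y.
  rewrite /compactly_supported [X in closure X](_ : _ = set0) ?closure0.
    exact: compact0.
  by apply/seteqP; split => // x; rewrite /= eqxx.
move=> a f g /asboolP[lf cf] /asboolP[lg cg]; apply/asboolP; split.
  move=> x; near=> y; rewrite !fctE.
  have -> : f y = f x by near: y; exact: lf.
  by have -> : g y = g x by near: y; exact: lg.
apply: (@subclosed_compact _ _ (closure [set x | f x != 0] `|` closure [set x | g x != 0])).
- exact: closed_closure.
- exact: compactU.
- rewrite -closureU; apply: closure_subset => x /=; apply: contraPP.
  move=> /not_orP[/negP + /negP]; rewrite !negbK => /eqP fx /eqP gx.
  by apply/negP; rewrite negbK !fctE fx gx scaler0 addr0.
Unshelve. all: by end_near. Qed.

HB.instance Definition _ := GRing.isSubmodClosed.Build R[i] (adele -> R[i])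
  bruhat_schwartz_pred (GRing.submod_closed_semi bruhat_schwartz_submod).

Record bruhat_schwartz := BruhatSchwartz {
  bruhat_schwartz_val :> adele -> R[i];
  _ : bruhat_schwartz_val \in bruhat_schwartz_pred }.

HB.instance Definition _ := [isSub for bruhat_schwartz_val].
HB.instance Definition _ := [Choice of bruhat_schwartz by <:].
HB.instance Definition _ := [SubChoice_isSubLmodule of bruhat_schwartz by <:].

(* The subspace D^l_k. *)
Definition level_space (l k : int) : set bruhat_schwartz :=
  [set f | (forall x, f x != 0 -> lattice k x) /\
           (forall x y, lattice l y -> f (x + y) = f x)].

Definition absolutely_convex (U : set bruhat_schwartz) : Prop :=
  forall (a b : R[i]) f g, `|a| + `|b| <= 1 -> U f -> U g -> U (a *: f + b *: g).

(* The basic neighbourhoods of 0 for the locally convex inductive limit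
   topology: the absolutely convex sets whose trace on each finite-dimensional
   space D^l_k is a neighbourhood of 0, here with respect to the sup norm. *)
Definition inductive_nbhs0 (U : set bruhat_schwartz) : Prop :=
  absolutely_convex U /\
  forall l k : int, l <= k -> exists2 e : R, 0 < e &
    forall f, level_space l k f -> (forall x, `|f x| < e%:C) -> U f.

Definition bruhat_schwartz_nbhs (f : bruhat_schwartz) (A : set bruhat_schwartz) :=
  exists2 U, inductive_nbhs0 U & forall g, U (g - f) -> A g.

Lemma inductive_nbhs0_0 U : inductive_nbhs0 U -> U 0.
Proof.
move=> [_ /(_ 0 0 (lexx _))[e e0]]; apply.
  split => [x|x y _ //]; by rewrite eqxx.
by move=> x; rewrite normr0 ltcR.
Qed.

Fact bruhat_schwartz_nbhs_filter f : ProperFilter (bruhat_schwartz_nbhs f).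
Proof.
apply: Build_ProperFilter_ex.
  move=> A [U /inductive_nbhs0_0 U0 UA]; exists f.
  by apply: UA; rewrite subrr.
split.
- exists setT => //; split => // l k _; by exists 1.
- move=> A B [U [aU nU] UA] [V [aV nV] VB]; exists (U `&` V).
    split.
      move=> a b g h ab [Ug Vg] [Uh Vh].
      by split; [exact: aU|exact: aV].
    move=> l k lk; have [e e0 He] := nU _ _ lk; have [d d0 Hd] := nV _ _ lk.
    exists (Num.min e d); first by rewrite lt_min e0.
    move=> g Dg sg; split; [apply: He|apply: Hd] => // x;
      apply: lt_le_trans (sg x) _; by rewrite lecR ge_min lexx ?orbT.
  by move=> g [Ug Vg]; split; [exact: UA|exact: VB].
- move=> A B AB [U nU UA]; exists U => // g /UA; exact: AB.
Qed.

Fact bruhat_schwartz_nbhs_singleton f A : bruhat_schwartz_nbhs f A -> A f.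
Proof. by move=> [U /inductive_nbhs0_0 U0]; apply; rewrite subrr. Qed.

Fact bruhat_schwartz_nbhs_nbhs f A :
  bruhat_schwartz_nbhs f A -> bruhat_schwartz_nbhs f (bruhat_schwartz_nbhs^~ A).
Proof.
move=> [U [aU nU] UA].
pose V : set bruhat_schwartz := [set g | U (2 *: g)].
have val2 (h : bruhat_schwartz) x : (2 *: h : bruhat_schwartz) x = 2 * h x by [].
have nV : inductive_nbhs0 V.
  split=> [a b g h ab Vg Vh|l k lk].
    rewrite /V /= scalerDr !scalerA ![2 * _]mulrC -!scalerA.
    exact: aU.
  have [e e0 He] := nU _ _ lk; exists (e / 2); first by rewrite divr_gt0.
  move=> g [sg ig] ng; apply: He.
    split=> [x|x y ly].
      by rewrite val2 mulf_eq0 negb_or => /andP[_ /sg].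
    by rewrite !val2 ig.
  move=> x; rewrite val2 normrM.
  have -> : `|2| = 2 :> R[i] by rewrite normr_nat.
  have := ng x; rewrite rmorphM fmorphV rmorph_nat.
  by rewrite ltr_pdivlMr ?ltr0n // mulrC.
exists V => // g Vg; exists V => // h Vh; apply: UA.
have -> : h - f = 2^-1 *: (2 *: (h - g)) + 2^-1 *: (2 *: (g - f)).
  by rewrite !scalerA mulVf ?pnatr_eq0 // !scale1r addrA subrK.
apply: aU => //.
by rewrite ger0_norm ?invr_ge0 ?ler0n // -[2^-1]mul1r -splitr.
Qed.

HB.instance Definition _ := hasNbhs.Build bruhat_schwartz bruhat_schwartz_nbhs.
HB.instance Definition _ := Nbhs_isNbhsTopological.Build bruhat_schwartz
  bruhat_schwartz_nbhs_filter bruhat_schwartz_nbhs_singleton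
  bruhat_schwartz_nbhs_nbhs.

End BruhatSchwartz.

Definition adele_borel := g_sigma_algebraType (@open adele).

Section Fourier.
Variable R : realType.
Variable mu : {measure set adele_borel -> \bar R}.
Local Open Scope complex_scope.

(* Regularity is automatic: A_f is locally compact with a countable base. *)
Definition is_haar : Prop :=
  [/\ forall (x : adele) (A : set adele), open.-sigma.-measurable A ->
        mu [set x + y | y in A] = mu A,
      forall K : set adele, compact K -> (mu K < +oo)%E &
      forall U : set adele, open U -> U !=set0 -> (0 < mu U)%E].

Definition Cintegral (f : adele -> R[i]) : R[i] :=
  (\int[mu]_x complex.Re (f x)) +i* (\int[mu]_x complex.Im (f x)).

Definition fourier (f : adele -> R[i]) (xi : adele) : R[i] :=
  Cintegral (fun x => f x * chi R (xi * x)).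

End Fourier.

(* Main.v *)
(* A Bruhat-Schwartz function is supported in (1/m)Zhat and invariant under
   m Zhat for some m >= 1. On such functions the Haar integral is 1/m times the
   sum of the values at the m^2 points j/m, and the Fourier transform, which
   preserves this finite-dimensional space, becomes the discrete Fourier
   transform of Z/m^2: inversion and Parseval reduce to the orthogonality of the
   roots of unity, and continuity to a sup-norm bound for each m. Outside
   (1/m)Zhat the transform vanishes because translating the integrand by m
   multiplies it by chi(m xi) <> 1. *)
From HB Require Import structures.
Require Import Defs.
From mathcomp Require Import all_boot all_order all_algebra.
From mathcomp Require Import ring_quotient generic_quotient ring lra finmap.
From mathcomp Require Import all_classical all_reals all_analysis.
From mathcomp Require Import complex.
Import Order.TTheory GRing.Theory Num.Theory.
Local Open Scope classical_set_scope.
Local Open Scope ring_scope.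

Set Implicit Arguments.
Unset Strict Implicit.
Unset Printing Implicit Defensive.

(** * p-adic numbers *)

(** [padic p] is a bare quotient of Cauchy sequences: the norm lives on the rationals and is never
    extended to the completion. Closeness is therefore always expressed by integrality, [x] and [y]
    being close when their difference divided by a natural number n is integral, and questions about
    adeles end as divisibility of integers.

    Taking one m both for the support bound and for the period is what makes each finite-dimensional
    space stable, because the transform exchanges these two properties. The central identity is that
    the transform applied twice is the reflection x -> -x. The inverse is then the reflection after
    the transform, so bijectivity, the inversion formula and the continuity of the inverse all come
    from that identity, and Parseval follows by expanding one factor with it. *)

Section PadicTheory.
Variable p : prime_nat.
Local Notation nrm := (padic_norm (val p)).

Let p_pr : prime (val p) := valP p.
Let p_gt0 : (0 : rat) < (val p)%:R. Proof. by rewrite ltr0n prime_gt0. Qed.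
Let p_neq0 : ((val p)%:R : rat) != 0. Proof. by rewrite gt_eqF. Qed.

Lemma padic_of_seq_eq (u v : padic_seq p) :
  padic_of_seq u = padic_of_seq v <-> padic_null p (u - v).
Proof.
rewrite /padic_of_seq; split=> [/eqP|h]; last apply/eqP.
  by rewrite -Quotient.idealrBE => /asboolP.
by rewrite -Quotient.idealrBE; apply/asboolP.
Qed.

Lemma padic_of_rat_zmod_morphism : zmod_morphism (@padic_of_rat p).
Proof.
move=> q r; rewrite /padic_of_rat -padic_of_seqB; congr padic_of_seq.
exact: val_inj.
Qed.

Lemma padic_of_rat_monoid_morphism : monoid_morphism (@padic_of_rat p).
Proof.
split=> [|q r].
  rewrite /padic_of_rat (_ : PadicSeq _ = 1); first exact: rmorph1.
  exact: val_inj.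
rewrite /padic_of_rat -padic_of_seqM; congr padic_of_seq.
exact: val_inj.
Qed.

HB.instance Definition _ :=
  GRing.isZmodMorphism.Build rat (padic p) (@padic_of_rat p)
    padic_of_rat_zmod_morphism.
HB.instance Definition _ :=
  GRing.isMonoidMorphism.Build rat (padic p) (@padic_of_rat p)
    padic_of_rat_monoid_morphism.

(** An integral sequence representing q has a term at distance less than 1 from q; by the
    ultrametric inequality this single term bounds the norm of q. *)
Lemma padic_int_ratP q : padic_int (padic_of_rat p q) <-> nrm q <= 1.
Proof.
split=> [[u /padic_of_seq_eq h hu]|h]; last first.
  by exists (PadicSeq (padic_const_subproof p q)).
have [N /(_ N (leqnn _)) hN] := h 1 ltr01.
rewrite -(subrK (u N) q) (le_trans (padic_normD p_pr _ _)) // ge_max hu andbT.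
exact: ltW.
Qed.

Lemma padic_int_eventually (u : padic_seq p) N :
  (forall n, (N <= n)%N -> nrm (u n) <= 1) -> padic_int (padic_of_seq u).
Proof.
move=> hN.
(* Freezing the first N terms at [u N] makes every term integral and changes only finitely many of
   them. *)
have cu : (fun n => u (maxn n N)) \in padic_cauchy_pred p.
  apply/asboolP => e e0; have /asboolP/(_ e e0) [M HM] := valP u.
  exists M => m n Mm Mn; apply: HM.
    exact: leq_trans Mm (leq_maxl _ _).
  exact: leq_trans Mn (leq_maxl _ _).
exists (PadicSeq cu); last by move=> n; apply: hN; exact: leq_maxr.
apply/padic_of_seq_eq => e e0; exists N => n Nn.
rewrite [X in nrm X](_ : _ = u n - u (maxn n N)) //.
by rewrite (maxn_idPl Nn) subrr padic_norm0.
Qed.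

Lemma padic_normp : nrm (val p)%:R = (val p)%:R^-1.
Proof.
have := @padic_normE _ p_pr (val p)%:Z 1; rewrite divr1 => -> //.
  by rewrite absz1 logn1 expr0 lognE p_pr prime_gt0 // dvdnn divnn
    prime_gt0 //= logn1 expr1 mul1r.
by rewrite eqz_nat -lt0n prime_gt0.
Qed.

(** A term of the Cauchy sequence past which all distances are below 1/p serves as q: the error
    divided by p is still integral. Facts about rationals reach [padic p] through this lemma. *)
Lemma padic_approx (x : padic p) :
  exists q z, padic_int z /\ x = padic_of_rat p q + (val p)%:R * z.
Proof.
elim/quotW: x => u; rewrite -/(padic_of_seq u).
have /asboolP/(_ (val p)%:R^-1) [|N HN] := valP u; first by rewrite invr_gt0.
pose c q := PadicSeq (padic_const_subproof p q).
pose w : padic_seq p := c (val p)%:R^-1 * (u - c (u N)).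
exists (u N), (padic_of_seq w); split.
  apply: (@padic_int_eventually _ N) => n Nn.
  rewrite [X in nrm X](_ : _ = (val p)%:R^-1 * (u n - u N)) //.
  have h : nrm (val p)%:R * nrm (val p)%:R^-1 = 1.
    by rewrite -padic_normM // divff // padic_norm1.
  rewrite padic_normM // -[leRHS]h padic_normp.
  have n0 : nrm (val p)%:R^-1 != 0.
    by apply/eqP => h0; move: h; rewrite h0 mulr0 => /eqP; rewrite eq_sym oner_eq0.
  rewrite mulrC ler_pM2r ?lt_neqAle ?padic_norm_ge0 1?eq_sym ?n0 //.
  exact: ltW (HN _ _ Nn (leqnn _)).
rewrite /w padic_of_seqM padic_of_seqB -/(padic_of_rat p _) -/(padic_of_rat p _).
by rewrite mulrA -(rmorph_nat (@padic_of_rat p)) -rmorphM /= divff //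
  rmorph1 mul1r addrCA subrr addr0.
Qed.

Lemma padic_int_intr (n : int) : padic_int (n%:~R : padic p).
Proof.
case: n => n; first exact: padic_int_nat.
by rewrite NegzE rmorphN; apply: padic_intN; exact: padic_int_nat.
Qed.

Lemma padic_denominator (x : padic p) : exists2 n, (0 < n)%N & padic_int (n%:R * x).
Proof.
have [q [z [iz ->]]] := padic_approx x.
exists `|denq q|%N; first by rewrite absz_gt0 denq_neq0.
rewrite mulrDr; apply: padic_intD; last first.
  apply: padic_intM; first exact: padic_int_nat.
  by apply: padic_intM => //; exact: padic_int_nat.
rewrite -(rmorph_nat (@padic_of_rat p)) -rmorphM /=.
have -> : (`|denq q|%N%:R * q = (numq q)%:~R)%R.
  rewrite -[X in X * _]/((`|denq q|%N : int)%:~R) absz_denq.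
  by rewrite -[X in _ * X]divq_num_den mulrCA divff ?mulr1 // intr_eq0 denq_neq0.
by rewrite rmorph_int; exact: padic_int_intr.
Qed.

Lemma padic_int_inv_nat n : (0 < n)%N -> ~~ (val p %| n)%N ->
  padic_int (padic_of_rat p n%:R^-1).
Proof.
move=> n0 pn; apply/padic_int_ratP.
have := @padic_normE _ p_pr 1 n%:Z; rewrite mul1r => -> //; last first.
  by rewrite eqz_nat -lt0n.
by rewrite absz1 logn1 expr0 divr1 logn_coprime ?prime_coprime.
Qed.

Lemma padic_norm_le1_denq q : nrm q <= 1 -> ~~ (val p %| `|denq q|)%N.
Proof.
have [->|q0] := eqVneq q 0.
  by rewrite dvdn1 gtn_eqF // prime_gt1.
move=> qle1.
apply/negP => pb; move: qle1; rewrite /padic_norm (negPf q0).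
have -> : logn (val p) `|numq q| = 0%N.
  rewrite logn_coprime // prime_coprime //; apply/negP => pa.
  have := coprime_num_den q; rewrite /coprime => /eqP h.
  have : (val p %| gcdn `|numq q| `|denq q|)%N by rewrite dvdn_gcd pa.
  by rewrite h dvdn1 => /eqP p1; move: p_pr; rewrite p1.
rewrite expr0 divr1 => h.
have : 1 < (val p)%:R ^+ logn (val p) `|denq q| :> rat.
  rewrite exprn_egt1 ?ltr1n ?prime_gt1 //.
  by rewrite -lt0n logn_gt0 mem_primes p_pr absz_gt0 denq_neq0.
by move/(le_lt_trans h); rewrite ltxx.
Qed.

Lemma padic_int_residue (x : padic p) : padic_int x ->
  exists2 j, (j < val p)%N & padic_int (padic_of_rat p (val p)%:R^-1 * (x - j%:R)).
Proof.
have [q [z [iz ->]]] := padic_approx x => iqz.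
have {iqz} : padic_int (padic_of_rat p q).
  rewrite -(addrK ((val p)%:R * z) (padic_of_rat p q)); apply: padic_intB => //.
  by apply: padic_intM => //; exact: padic_int_nat.
have pz0 : (val p : int) != 0 by rewrite eqz_nat -lt0n prime_gt0.
have [->|q0] := eqVneq q 0.
  exists 0%N; first by rewrite prime_gt0.
  rewrite subr0 rmorph0 add0r mulrA -(rmorph_nat (@padic_of_rat p)) -rmorphM /=.
  by rewrite mulVf // rmorph1 mul1r.
move/padic_int_ratP => qle1; set b := denq q; set a := numq q.
have pb : ~~ (val p %| `|b|)%N by exact: padic_norm_le1_denq.
have /coprimezP [[u v] /= uv] : coprimez b (val p).
  by rewrite coprimezE coprime_sym prime_coprime.
pose j := `|((a * u) %% (val p))%Z|%N.
have jE : (j : int) = ((a * u) %% (val p))%Z by rewrite /j gez0_abs // modz_ge0.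
exists j; first by rewrite -ltz_nat jE ltz_pmod // ltz_nat prime_gt0.
(* From u b + v p = 1 and a u = s p + j one gets a - j b = p (a v + s b); hence q - j = p t / b,
   with b prime to p. *)
pose t : int := a * v + ((a * u) %/ val p)%Z * b.
have e : q = j%:R + (val p)%:R * (t%:~R * (`|b|%N)%:R^-1).
  have bE : (`|b|%N%:R : rat) = b%:~R.
    by rewrite -[LHS]/((`|b|%N : int)%:~R) absz_denq.
  have b0 : (b%:~R : rat) != 0 by rewrite intr_eq0 denq_neq0.
  apply: (mulIf b0); rewrite bE mulrDl -[RHS]addrC -!mulrA mulVf // mulr1.
  rewrite -{1}[q]divq_num_den -/a -/b -mulrA mulVf // mulr1.
  have -> : (j%:R : rat) = (j : int)%:~R by [].
  have -> : ((val p)%:R : rat) = (val p : int)%:~R by [].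
  rewrite -!intrM -intrD; congr (_%:~R).
  rewrite jE /t -[LHS]mulr1 -uv mulrDr mulrA.
  have := divz_eq (a * u) (val p).
  by move: (_ %/ _)%Z (_ %% _)%Z => s r ->; ring.
rewrite {1}e rmorphD rmorph_nat rmorphM /= rmorph_nat.
rewrite [X in _ * X](_ : _ = (val p)%:R * (padic_of_rat p (t%:~R / `|b|%:R) + z)).
  rewrite mulrA -(rmorph_nat (@padic_of_rat p)) -rmorphM /= mulVf // rmorph1 mul1r.
  apply: padic_intD => //; rewrite rmorphM /=; apply: padic_intM.
    by rewrite rmorph_int; exact: padic_int_intr.
  by apply: padic_int_inv_nat => //; rewrite absz_gt0 denq_neq0.
by rewrite mulrDr -[X in X - _]addrA [LHS]addrC addKr.
Qed.

End PadicTheory.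

(** * Finite adeles *)

Lemma padic_open_ball p (x : padic p) n : open (padic_ball x n).
Proof.
exists [set padic_ball x n]; first by move=> _ ->; exists x => //; exists n.
by rewrite bigcup_set1.
Qed.

Lemma padic_nbhs_ball p (x : padic p) (U : set (padic p)) :
  open U -> U x -> exists n, padic_ball x n `<=` U.
Proof.
move=> [D DB <-] [B DB' Bx].
have [y _ [k _ e]] := DB _ DB'; subst B.
exists k => z /(padic_ball_sub Bx (leqnn k)) h; by exists (padic_ball y k).
Qed.

Lemma adele_of_rat_zmod_morphism : zmod_morphism adele_of_rat.
Proof.
move=> q r; apply: val_inj; apply: functional_extensionality_dep => p.
exact: (rmorphB (@padic_of_rat p)).
Qed.

Lemma adele_of_rat_monoid_morphism : monoid_morphism adele_of_rat.
Proof.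
split=> [|q r]; apply: val_inj; apply: functional_extensionality_dep => p.
  exact: (rmorph1 (@padic_of_rat p)).
exact: (rmorphM (@padic_of_rat p)).
Qed.

HB.instance Definition _ :=
  GRing.isZmodMorphism.Build rat adele adele_of_rat adele_of_rat_zmod_morphism.
HB.instance Definition _ :=
  GRing.isMonoidMorphism.Build rat adele adele_of_rat adele_of_rat_monoid_morphism.

Lemma adele_coord_nat n p : (n%:R : adele) p = n%:R.
Proof.
rewrite -(rmorph_nat adele_of_rat) -(rmorph_nat (@padic_of_rat p)); by [].
Qed.

Lemma ZhatB x y : Zhat x -> Zhat y -> Zhat (x - y).
Proof. by move=> hx hy p; apply: (padic_intB (hx p) (hy p)). Qed.

Lemma Zhat0 : Zhat 0. Proof. by move=> p; exact: padic_int0. Qed.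

Lemma Zhat1 : Zhat 1. Proof. by move=> p; exact: padic_int1. Qed.

Lemma ZhatN x : Zhat x -> Zhat (- x).
Proof. by move=> hx; rewrite -sub0r; apply: ZhatB => //; exact: Zhat0. Qed.

Lemma ZhatNE x : Zhat (- x) <-> Zhat x.
Proof. by split=> /ZhatN; rewrite ?opprK. Qed.

Lemma ZhatD x y : Zhat x -> Zhat y -> Zhat (x + y).
Proof. by move=> hx /ZhatN hy; rewrite -[y]opprK; exact: ZhatB. Qed.

Lemma ZhatM x y : Zhat x -> Zhat y -> Zhat (x * y).
Proof. by move=> hx hy p; apply: (padic_intM (hx p) (hy p)). Qed.

Lemma Zhat_nat n : Zhat n%:R.
Proof. by move=> p; rewrite adele_coord_nat; exact: padic_int_nat. Qed.

Lemma Zhat_intr (n : int) : Zhat n%:~R.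
Proof.
case: n => n; first exact: Zhat_nat.
by rewrite NegzE rmorphN; apply: ZhatN; exact: Zhat_nat.
Qed.

(** This turns adelic integrality into divisibility in Z. A denominator greater than 1 has a prime
    divisor, and integrality fails at that coordinate. *)
Lemma Zhat_ratP q : Zhat (adele_of_rat q) <-> q \is a Num.int.
Proof.
split=> [h|/intrP [n ->]]; last by rewrite rmorph_int; exact: Zhat_intr.
rewrite Qint_def; have [//|d1] := eqVneq (denq q) 1.
have d2 : (1 < `|denq q|)%N.
  rewrite ltn_neqAle absz_gt0 denq_neq0 andbT eq_sym.
  by rewrite -eqz_nat absz_denq.
pose p : prime_nat := exist _ (pdiv `|denq q|) (pdiv_prime d2).
have /padic_int_ratP/padic_norm_le1_denq := h p.
by rewrite /p /= pdiv_dvd.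
Qed.

Lemma adele_natVM n (x : adele) : (0 < n)%N -> adele_of_rat n%:R^-1 * (n%:R * x) = x.
Proof.
move=> n0; rewrite mulrA -(rmorph_nat adele_of_rat) -rmorphM /= mulVf ?rmorph1 ?mul1r //.
by rewrite pnatr_eq0 -lt0n.
Qed.

Lemma adele_natMV n (x : adele) : (0 < n)%N -> n%:R * (adele_of_rat n%:R^-1 * x) = x.
Proof. by move=> n0; rewrite mulrCA adele_natVM. Qed.

(** The ring of adeles has zero divisors, but positive integers are units in it. *)
Lemma adele_natI n : (0 < n)%N -> injective ( *%R (n%:R : adele)).
Proof. by move=> n0 x y /(congr1 ( *%R (adele_of_rat n%:R^-1))); rewrite !adele_natVM. Qed.

Lemma Zhat_residue_prime (p : prime_nat) x : Zhat x ->
  exists j z, [/\ (j < val p)%N, Zhat z & x = j%:R + (val p)%:R * z].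
Proof.
move=> hx; have p0 : (0 < val p)%N by rewrite prime_gt0 // (valP p).
have [j jp hj] := padic_int_residue (hx p).
exists j, (adele_of_rat (val p)%:R^-1 * (x - j%:R)); split=> //; last first.
  by rewrite adele_natMV // addrC subrK.
move=> r; have [<-|pr] := eqVneq p r.
  by have -> // : (adele_of_rat (val p)%:R^-1 * (x - j%:R)) p =
     padic_of_rat p (val p)%:R^-1 * (x p - j%:R); rewrite -adele_coord_nat.
have xj : Zhat (x - j%:R) by apply: ZhatB => //; exact: Zhat_nat.
apply: (padic_intM _ (xj r)); apply: padic_int_inv_nat => //.
rewrite dvdn_prime2 ?(valP r) ?(valP p) //; apply: contra pr => /eqP e.
by apply/eqP/val_inj.
Qed.

(* Induction on the prime factors of n: dividing by a prime affects only one
   coordinate, so the Chinese remainder theorem is not needed. *)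
Lemma Zhat_residue n x : (0 < n)%N -> Zhat x ->
  exists j z, [/\ (j < n)%N, Zhat z & x = j%:R + n%:R * z].
Proof.
elim/ltn_ind: n x => n IH x n0 hx.
have [n1|n1] := leqP n 1.
  have -> : n = 1%N by apply/eqP; rewrite eqn_leq n1.
  by exists 0%N, x; split => //; rewrite mul1r add0r.
pose p : prime_nat := exist _ (pdiv n) (pdiv_prime n1).
have [j [z [jp hz ->]]] := Zhat_residue_prime p hx.
have p0 : (0 < val p)%N by exact: pdiv_gt0.
have /dvdnP [m nE] : (val p %| n)%N by exact: pdiv_dvd.
have m0 : (0 < m)%N by case: m nE n0 => // ->.
have mn : (m < n)%N by rewrite nE ltn_Pmulr // prime_gt1 // (valP p).
have [i [w [im hw ->]]] := IH m mn z m0 hz.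
exists (j + val p * i)%N, w; split => //.
  rewrite nE; apply: (@leq_trans (val p * i.+1)%N).
    by rewrite mulnS ltn_add2r.
  by rewrite mulnC leq_mul2r im orbT.
by rewrite nE natrD !natrM mulrDr addrA mulrA [_%:R * m%:R]mulrC.
Qed.

Lemma finite_common_multiple (A : set prime_nat) (n : prime_nat -> nat) :
  finite_set A -> (forall p, (0 < n p)%N) ->
  exists2 d, (0 < d)%N & forall p, A p -> (n p %| d)%N.
Proof.
move=> /finite_seqP [s ->] n0; exists (\prod_(p <- s) n p)%N.
  by rewrite prodn_gt0.
by move=> p ps; rewrite (big_rem p) //= dvdn_mulr.
Qed.

Lemma adele_denominator (x : adele) : exists2 n, (0 < n)%N & Zhat (n%:R * x).
Proof.
have /choice [f hf] p : exists n, (0 < n)%N /\ padic_int (n%:R * x p).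
  by have [n n0 h] := padic_denominator (x p); exists n.
have /asboolP := valP x => /finite_common_multiple - /(_ f) [p|d d0 hd].
  by case: (hf p).
exists d => // p.
have -> : (d%:R * x) p = d%:R * x p by rewrite -adele_coord_nat.
have [xp|xp] := pselect (padic_int (x p)).
  by apply: padic_intM => //; exact: padic_int_nat.
have /dvdnP [k ->] := hd p xp.
rewrite natrM -mulrA; apply: padic_intM; first exact: padic_int_nat.
by case: (hf p).
Qed.

Lemma adele_open_coset (x : adele) n : (0 < n)%N ->
  open [set x + n%:R * y | y in Zhat].
Proof.
move=> n0.
(* The factor must be literally [padic_int] at almost all p, as [adele_boxes] requires. The
   exceptions are the prime divisors of n and the finitely many p where [x p] is not integral. *)
pose U p := if `[< ~~ (val p %| n)%N /\ padic_int (x p) >] then @padic_int p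
            else padic_ball (x p) (logn (val p) n).
have Ux p : U p (x p).
  by rewrite /U; case: asboolP => [[]//|_]; exact: padic_ball_center.
have -> : [set x + n%:R * y | y in Zhat] = adele_box U.
  apply/seteqP; split=> [_ [z hz <-] p|y hy].
    have -> : (x + n%:R * z) p = x p + n%:R * z p by rewrite -adele_coord_nat.
    rewrite /U; case: asboolP => [[_ ix]|_].
      by apply: padic_intD => //; apply: padic_intM => //; exact: padic_int_nat.
    have [k e] := dvdnP (pfactor_dvdnn (val p) n).
    exists (k%:R * z p); first by apply: padic_intM => //; exact: padic_int_nat.
    by rewrite mulrA -natrX -natrM mulnC -e.
  exists (adele_of_rat n%:R^-1 * (y - x)); last first.
    by rewrite adele_natMV // addrC subrK.
  move=> p; have -> : (adele_of_rat n%:R^-1 * (y - x)) p =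
     padic_of_rat p n%:R^-1 * (y p - x p) by [].
  have := hy p; rewrite /U; case: asboolP => [[pn ix] iy|_ [z iz <-]].
    apply: padic_intM; last exact: padic_intB.
    exact: padic_int_inv_nat.
  rewrite [x p + _]addrC addrK mulrA; apply: padic_intM => //.
  have [k pk e] := pfactor_coprime (valP p) n0.
  rewrite -natrX -(rmorph_nat (@padic_of_rat p)) -rmorphM /=.
  have k0 : (0 < k)%N by case: k e {pk} => // e; rewrite e in n0.
  have -> : n%:R^-1 * (val p ^ logn (val p) n)%:R = k%:R^-1 :> rat.
    rewrite {1}e natrM invfM -mulrA mulVf ?mulr1 //.
    by rewrite pnatr_eq0 -lt0n expn_gt0 prime_gt0 // (valP p).
  by apply: padic_int_inv_nat => //; rewrite -prime_coprime // (valP p).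
exists [set adele_box U]; last by rewrite bigcup_set1.
move=> _ ->; exists U => //; split=> [p|].
  by rewrite /U; case: asboolP => _; [exact: open_padic_int|exact: padic_open_ball].
apply: (@sub_finite_set _ _ (val @^-1` [set` primes n] `|` [set p | ~ padic_int (x p)])).
  move=> p /= h; have [ix|nx] := pselect (padic_int (x p)); last by right.
  left => /=; rewrite mem_primes (valP p) n0 /=.
  apply: contrapT => /negP pn; apply: h; rewrite /U.
  by case: asboolP => // -[]; split.
rewrite finite_setU; split; last by have /asboolP := valP x.
by apply: finite_preimage => [? ? _ _|]; [exact: val_inj|exact: finite_seq].
Qed.

(** Replaces the restricted product topology by divisibility. A box constrains only finitely many
    coordinates beyond integrality, and the product of the corresponding prime powers is a suitable
    n. *)
Lemma adele_nbhsP (x : adele) (A : set adele) :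
  nbhs x A <-> exists2 n, (0 < n)%N & forall y, Zhat y -> A (x + n%:R * y).
Proof.
split=> [|[n n0 h]]; last first.
  rewrite nbhsE; exists [set x + n%:R * y | y in Zhat]; last by move=> _ [y hy <-]; exact: h.
  split; first exact: adele_open_coset.
  by exists 0; [exact: Zhat0|rewrite mulr0 addr0].
rewrite nbhsE => -[B [[D DB <-] [C DC Cx]] BA].
have [U [oU fU] e] := DB _ DC; subst C.
have /choice [f hf] p : exists k, padic_ball (x p) k `<=` U p.
  by apply: padic_nbhs_ball => //; exact: Cx.
have [p|d d0 hd] := finite_common_multiple (n := fun p => (val p ^ f p)%N) fU.
  by rewrite expn_gt0 prime_gt0 // (valP p).
exists d => // y hy; apply: BA; exists (adele_box U) => // p.
have -> : (x + d%:R * y) p = x p + d%:R * y p by rewrite -adele_coord_nat.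
have [UE|/hd/dvdnP [k ->]] := pselect (U p = @padic_int p).
  rewrite UE; apply: padic_intD; first by rewrite -UE; exact: Cx.
  by apply: padic_intM => //; exact: padic_int_nat.
apply: hf; exists (k%:R * y p).
  by apply: padic_intM => //; exact: padic_int_nat.
by rewrite natrM natrX mulrA [k%:R * _]mulrC.
Qed.

(** * Compactness of the profinite integers *)

(** The part of n prime to p is a unit of Z_p, so only the power of p in n matters. *)
Lemma padic_int_natV_mul p n (y : padic p) : (0 < n)%N ->
  padic_int (padic_of_rat p (val p ^ logn (val p) n)%:R^-1 * y) ->
  padic_int (padic_of_rat p n%:R^-1 * y).
Proof.
move=> n0 hy; have [k pk e] := pfactor_coprime (valP p) n0.
have k0 : (0 < k)%N by case: k e {pk} => // e; rewrite e in n0.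
rewrite {1}e natrM invfM rmorphM -mulrA; apply: padic_intM => //.
by apply: padic_int_inv_nat => //; rewrite -prime_coprime // (valP p).
Qed.

Lemma padic_norm_small p (y : rat) k :
  padic_int (padic_of_rat p ((val p ^ k)%:R^-1 * y)) ->
  padic_norm (val p) y <= (val p)%:R^-1 ^+ k.
Proof.
move/padic_int_ratP; rewrite padic_normM ?(valP p) // => h.
have hp : padic_norm (val p) (val p ^ k)%:R = (val p)%:R^-1 ^+ k.
  elim: k {h} => [|k IH]; first by rewrite expn0 expr0 padic_norm1 ?(valP p).
  by rewrite expnS natrM padic_normM ?(valP p) // IH padic_normp exprS.
have n1 : padic_norm (val p) (val p ^ k)%:R * padic_norm (val p) (val p ^ k)%:R^-1 = 1.
  rewrite -padic_normM ?(valP p) // divff ?padic_norm1 ?(valP p) //.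
  by rewrite pnatr_eq0 expn_eq0 -[val p == _]negbK -lt0n prime_gt0 // (valP p).
have -> : padic_norm (val p) y = padic_norm (val p) (val p ^ k)%:R *
    (padic_norm (val p) (val p ^ k)%:R^-1 * padic_norm (val p) y).
  by rewrite mulrA n1 mul1r.
by rewrite -hp ler_piMr ?padic_norm_ge0.
Qed.

Lemma prime_invX_small (p : nat) (e : rat) : prime p -> 0 < e ->
  exists N, forall n, (N <= n)%N -> p%:R^-1 ^+ n < e.
Proof.
move=> pp e0; have p0 : (0 : rat) < p%:R by rewrite ltr0n prime_gt0.
exists (Num.bound e^-1) => n Nn.
rewrite -[ltRHS]invrK exprVn ltf_pV2 ?posrE ?invr_gt0 ?exprn_gt0 //.
apply: lt_le_trans (archi_boundP _) _; first by rewrite invr_ge0 ltW.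
rewrite -natrX ler_nat (leq_trans Nn) // ltnW //.
exact: ltn_expl (prime_gt1 pp).
Qed.

(** The compatible residues, read as rationals, are themselves a Cauchy sequence, and x is its
    class. *)
Lemma padic_residue_limit (p : prime_nat) (a : nat -> nat) :
  (forall k l, (k <= l)%N -> (a l = a k %[mod val p ^ k])%N) ->
  exists x : padic p, forall k,
    padic_int (padic_of_rat p (val p ^ k)%:R^-1 * (x - (a k)%:R)).
Proof.
move=> ha.
have pk0 k : ((val p ^ k)%:R : rat) != 0.
  by rewrite pnatr_eq0 -lt0n expn_gt0 prime_gt0 ?(valP p).
have div k l : (k <= l)%N ->
    padic_int (padic_of_rat p ((val p ^ k)%:R^-1 * ((a l)%:R - (a k)%:R))).
  move=> kl; have : (((val p ^ k)%N : int) %| (a l : int) - (a k : int))%Z.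
    by rewrite -eqz_mod_dvd; apply/eqP; rewrite !modz_nat ha.
  move=> /dvdzP [q e].
  have -> : ((a l)%:R - (a k)%:R : rat) = q%:~R * (val p ^ k)%:R.
    by rewrite -[(a l)%:R]/((a l : int)%:~R) -[(a k)%:R]/((a k : int)%:~R) -rmorphB /= e intrM.
  by rewrite mulrCA mulVf // mulr1 rmorph_int; exact: padic_int_intr.
have cu : (fun k => (a k)%:R) \in padic_cauchy_pred p.
  apply/asboolP => e /(prime_invX_small (valP p)) [N HN]; exists N => m n Nm Nn.
  apply: le_lt_trans (HN N (leqnn _)).
  rewrite -[X in padic_norm _ X](subrKA (a N)%:R) (le_trans (padic_normD (valP p) _ _)) //.
  rewrite ge_max padic_norm_small /=; last exact: div.
  by rewrite -opprB padic_normN padic_norm_small; last exact: div.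
pose u := PadicSeq cu; exists (padic_of_seq u) => k.
pose c q := PadicSeq (padic_const_subproof p q).
rewrite -(rmorph_nat (@padic_of_rat p)) -padic_of_seqB -padic_of_seqM.
apply: (@padic_int_eventually _ _ k) => n kn.
by apply/(padic_int_ratP p); exact: div.
Qed.

(* An ultrafilter on Zhat selects one residue class modulo each n; its residues
   modulo the powers of p form a Cauchy sequence, whose limit in Q_p is the
   p-th coordinate of the limit point. *)
Lemma compact_Zhat : compact Zhat.
Proof.
rewrite compact_ultra => F FU FZ.
pose res (j n : nat) := [set x : adele | exists2 z, Zhat z & x = j%:R + n%:R * z].
have /choice [a ha] (n : nat) : exists j, (0 < n)%N -> F (res j n).
  have [->|n0] := posnP n; first by exists 0%N.
  (* If no residue class belonged to F, all n complements would, and their intersection misses Zhat,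
     which is in F. *)
  apply: contrapT => /forallNP H.
  have FN (j : 'I_n) : F (~` res j n).
    have [|//] := in_ultra_setVsetC (res j n) FU => Fj.
    by case: (H j).
  have FI : F (Zhat `&` [set x | forall j : 'I_n, ~ res j n x]).
    by apply: filterI => //; exact: filter_forall FN.
  have [x [/(Zhat_residue n0) [j [z [jn hz xE]]] /(_ (Ordinal jn))]] := filter_ex FI.
  by apply; exists z.
(* Two classes in F meet; comparing the two expressions of a common point gives the congruence. *)
have compat m k : (0 < m)%N -> (0 < k)%N -> (a (m * k) = a m %[mod m])%N.
  move=> m0 k0; have mk0 : (0 < m * k)%N by rewrite muln_gt0 m0.
  have FI : F (res (a m) m `&` res (a (m * k)%N) (m * k)%N).
    by apply: filterI; exact: ha.
  have [x [[z hz xz] [w hw xw]]] := filter_ex FI.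
  have : Zhat (adele_of_rat (((a (m * k)%N)%:R - (a m)%:R) / m%:R)).
    rewrite mulrC rmorphM rmorphB /= !rmorph_nat.
    have -> : ((a (m * k)%N)%:R - (a m)%:R : adele) = m%:R * (z - k%:R * w).
      by rewrite mulrBr mulrA -natrM; apply/eqP; rewrite subr_eq addrAC
        eq_sym subr_eq addrC -xz xw addrC.
    by rewrite adele_natVM //; apply: ZhatB => //; apply: ZhatM => //; exact: Zhat_nat.
  move/Zhat_ratP/intrP => [q e].
  have {}e : (a (m * k)%N : int) - (a m : int) = q * m.
    apply: (@intr_inj rat); rewrite rmorphB rmorphM /= -e divfK //.
    by rewrite pnatr_eq0 -lt0n.
  have : ((a (m * k)%N : int) = (a m : int) %[mod m])%Z.
    by apply/eqP; rewrite eqz_mod_dvd e dvdz_mull.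
  by rewrite !modz_nat => -[].
have pdiv (p : prime_nat) k l : (k <= l)%N ->
    (a (val p ^ l) = a (val p ^ k) %[mod val p ^ k])%N.
  move=> kl; rewrite -(subnKC kl) expnD; apply: compat;
    by rewrite expn_gt0 prime_gt0 // (valP p).
have [x hx] : exists x : padic_family, forall p k,
    padic_int (padic_of_rat p (val p ^ k)%:R^-1 * (x p - (a (val p ^ k)%N)%:R)).
  exists (fun p => sval (cid (padic_residue_limit (pdiv p)))) => p k.
  by case: cid => y /=; exact.
have ix p : padic_int (x p).
  have := hx p 0%N; rewrite expn0 invr1 rmorph1 mul1r => h.
  by rewrite -(subrK (a 1)%:R (x p)); apply: padic_intD => //; exact: padic_int_nat.
have ax : x \in adelic_pred.
  apply/asboolP; rewrite [X in finite_set X](_ : _ = set0) //.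
  by apply/seteqP; split => // p /=.
exists (Adele ax); split; first exact: ix.
move=> A /adele_nbhsP [n n0 hA]; apply: filterS (ha n n0) => y [z hz ->].
(* It remains to see that x is congruent to [a n] modulo n. At p this concerns only the power of p
   dividing n, where [a n] agrees with [a (p ^ k)] by [compat] and the latter with x by [hx]. *)
pose w : adele := adele_of_rat n%:R^-1 * (Adele ax - (a n)%:R).
have hw : Zhat w.
  move=> p.
  have -> : w p = padic_of_rat p n%:R^-1 * (x p - (a n)%:R).
    by rewrite -adele_coord_nat.
  apply: padic_int_natV_mul => //; set k := logn _ _.
  have pk0 : (0 < val p ^ k)%N by rewrite expn_gt0 prime_gt0 // (valP p).
  rewrite -(subrKA (a (val p ^ k)%N)%:R) mulrDr; apply: padic_intD => //.
  have /dvdnP [m nE] : (val p ^ k %| n)%N by exact: pfactor_dvdnn.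
  have m0 : (0 < m)%N by case: m nE n0 => // ->.
  have := compat _ _ pk0 m0; rewrite mulnC -nE => e.
  have : (((val p ^ k)%N : int) %| (a (val p ^ k)%N : int) - (a n : int))%Z.
    by rewrite -eqz_mod_dvd; apply/eqP; rewrite !modz_nat e.
  move=> /dvdzP [q {}e].
  rewrite -!(rmorph_nat (@padic_of_rat p)) -rmorphB -rmorphM /=.
  rewrite -[(a _)%:R]/((a _ : int)%:~R) -[(a n)%:R]/((a n : int)%:~R) -rmorphB /= e intrM.
  rewrite mulrCA mulVf ?mulr1 ?rmorph_int; first exact: padic_int_intr.
  by rewrite pnatr_eq0 -lt0n.
have -> : (a n)%:R + n%:R * z = Adele ax + n%:R * (z - w).
  by rewrite mulrBr adele_natMV // [RHS]addrCA subKr addrC.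
by apply: hA; exact: ZhatB.
Qed.

(** * Levels of Bruhat-Schwartz functions *)

Lemma lcm_value_gt0 n : (0 < lcm_value n)%N.
Proof. by elim: n => // n _; apply: leq_ltn_trans (lcm_value_increasing n). Qed.

Lemma lcm_upto_dvd m n : (m <= n)%N -> (lcm_upto m %| lcm_upto n)%N.
Proof.
move=> mn; rewrite /lcm_upto [X in (_ %| X)%N](@big_cat_nat _ _ _ m.+1) //=.
exact: dvdn_lcml.
Qed.

Lemma lcm_value_upto n : exists N, lcm_value n = lcm_upto N.
Proof.
have : range lcm_value (lcm_value n) by exists n.
by rewrite lcm_value_range => -[N _ <-]; exists N.
Qed.

Lemma lcm_value_dvd m n : (m <= n)%N -> (lcm_value m %| lcm_value n)%N.
Proof.
move=> mn; have le : (lcm_value m <= lcm_value n)%N.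
  rewrite -(subnKC mn); elim: (n - m)%N => [|d]; first by rewrite addn0.
  rewrite addnS => /leq_trans; apply; exact: ltnW (lcm_value_increasing _).
have [a ea] := lcm_value_upto m; have [b eb] := lcm_value_upto n.
(* The arguments of [lcm_upto] need not be ordered like m and n; in the opposite order divisibility
   holds both ways and the values coincide. *)
have [ab|/ltnW ba] := leqP a b; first by rewrite ea eb lcm_upto_dvd.
have dv : (lcm_value n %| lcm_value m)%N by rewrite ea eb lcm_upto_dvd.
have /(dvdn_leq (lcm_value_gt0 m)) ge := dv.
suff -> : lcm_value m = lcm_value n by [].
by apply/eqP; rewrite eqn_leq le.
Qed.

Lemma lattice_bounded (k : int) n x :
  (`|k| <= n)%N -> lattice k x -> Zhat ((lcm_value n)%:R * x).
Proof.
case: k => [j jn|j jn] [z hz <-] /=.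
  have /dvdnP [d ->] := lcm_value_dvd jn.
  rewrite natrM -mulrA adele_natMV ?lcm_value_gt0 //.
  by apply: ZhatM => //; exact: Zhat_nat.
rewrite invrK rmorph_nat.
by apply: ZhatM; [exact: Zhat_nat|apply: ZhatM => //; exact: Zhat_nat].
Qed.

Lemma lattice_deep (l : int) n z :
  (`|l| <= n)%N -> Zhat z -> lattice l ((lcm_value n)%:R * z).
Proof.
case: l => [j jn|j jn] hz /=.
  exists ((lcm_value j)%:R * ((lcm_value n)%:R * z)).
    by do 2 (apply: ZhatM; first exact: Zhat_nat).
  by rewrite /= adele_natVM // lcm_value_gt0.
have /dvdnP [d ->] := lcm_value_dvd jn.
exists (d%:R * z); first by apply: ZhatM => //; exact: Zhat_nat.
by rewrite /= invrK rmorph_nat natrM mulrA [d%:R * _]mulrC.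
Qed.

(* For m = lcm_value n this is D^{-n}_n; as n varies these spaces are cofinal
   among the D^l_k, so a single index suffices. *)
Definition level (T : nmodType) (m : nat) (f : adele -> T) : Prop :=
  (forall x, f x != 0 -> Zhat (m%:R * x)) /\
  (forall x y, Zhat y -> f (x + m%:R * y) = f x).

Lemma level_dvd (T : nmodType) m n (f : adele -> T) :
  (m %| n)%N -> level m f -> level n f.
Proof.
move=> /dvdnP [d ->] [sf inf]; split=> [x /sf hx|x y hy].
  by rewrite natrM -mulrA; apply: ZhatM => //; exact: Zhat_nat.
rewrite mulnC natrM -mulrA; apply: inf.
by apply: ZhatM => //; exact: Zhat_nat.
Qed.

Lemma level_support (T : nmodType) m (f : adele -> T) x :
  level m f -> ~ Zhat (m%:R * x) -> f x = 0.
Proof. by move=> [sf _] nx; apply/eqP; apply: contra_notT nx; exact: sf. Qed.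

Section BruhatSchwartzLevel.
Variable R : realType.

Lemma level_spaceN (n : nat) (f : bruhat_schwartz R) :
  level (lcm_value n) f -> level_space (- n%:Z) n%:Z f.
Proof.
move=> [sf inf]; split=> [x /sf hx|x y].
  exists ((lcm_value n)%:R * x) => //=.
  by rewrite adele_natVM // lcm_value_gt0.
(* [expsi] branches on the constructor, and - 0 is [Posz 0] rather than a [Negz]. *)
case: n {sf} inf => [|n] inf [z hz <-] /=; last first.
  by rewrite invrK rmorph_nat; exact: inf.
by rewrite invr1 rmorph1 -(inf x z hz).
Qed.

Lemma level_space_level (l k : int) n (f : bruhat_schwartz R) :
  (`|l| <= n)%N -> (`|k| <= n)%N -> level_space l k f -> level (lcm_value n) f.
Proof.
move=> ln kn [sf inf]; split=> [x /sf|x y hy].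
  exact: lattice_bounded.
by apply: inf; exact: lattice_deep.
Qed.

Lemma level_bruhat_schwartz m (f : adele -> R[i]) : (0 < m)%N -> level m f ->
  f \in @bruhat_schwartz_pred R.
Proof.
move=> m0 [sf inf]; apply/asboolP; split.
  move=> x; apply/adele_nbhsP; exists m => // y hy; exact: inf.
apply: (@subclosed_compact _ _ [set adele_of_rat m%:R^-1 * z | z in Zhat]).
- exact: closed_closure.
- apply: continuous_compact; last exact: compact_Zhat.
  apply: continuous_subspaceT => x A /adele_nbhsP [n n0 hA].
  apply/adele_nbhsP; exists (m * n)%N; first by rewrite muln_gt0 m0.
  move=> y hy /=; rewrite mulrDr natrM -mulrA adele_natVM //; exact: hA.
(* The open coset x + Zhat contains a support point z, and integrality of m z forces that of m x. *)
- move=> x cx; have : nbhs x [set x + 1%:R * y | y in Zhat].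
    by apply/adele_nbhsP; exists 1%N => // y hy; exists y.
  move=> /cx [z [sz [y hy ze]]]; move: (sf z sz); rewrite -ze mul1r mulrDr => h.
  exists (m%:R * x); last by rewrite adele_natVM.
  rewrite -(addrK (m%:R * y) (m%:R * x)); apply: ZhatB => //.
  by apply: ZhatM => //; exact: Zhat_nat.
Qed.

Lemma bruhat_schwartz_level (f : bruhat_schwartz R) :
  exists2 m, (0 < m)%N & level m f.
Proof.
have /asboolP [lf cf] := valP f.
(* Each [n x] is both a denominator of x and a period of f near x. Compactness leaves finitely many
   of them, and their product serves as m. *)
have /choice [n hn] x : exists n, [/\ (0 < n)%N, Zhat (n%:R * x) &
    forall y, Zhat y -> f (x + n%:R * y) = f x].
  have /adele_nbhsP [a a0 ha] := lf x; have [b b0 hb] := adele_denominator x.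
  exists (a * b)%N; split; first by rewrite muln_gt0 a0.
    by rewrite natrM -mulrA; apply: ZhatM => //; exact: Zhat_nat.
  move=> y hy; rewrite natrM -mulrA; apply: ha.
  by apply: ZhatM => //; exact: Zhat_nat.
have n0 x : (0 < n x)%N by case: (hn x).
have [] : finite_subset_cover (closure [set x | f x != 0])
    (fun x => [set x + (n x)%:R * y | y in Zhat]) (closure [set x | f x != 0]).
  move: cf; rewrite /compactly_supported compact_cover; apply.
    by move=> x _; exact: adele_open_coset.
  by move=> x cx; exists x => //; exists 0; [exact: Zhat0|rewrite mulr0 addr0].
move=> D _ cov.
pose m := (\prod_(x <- enum_fset D) n x)%N.
have m0 : (0 < m)%N by rewrite prodn_gt0.
have key y : f y != 0 -> Zhat (m%:R * y) /\ forall w, Zhat w -> f (y + m%:R * w) = f y.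
  move=> fy; have /cov [x /= xD [z hz yE]] : closure [set x | f x != 0] y.
    exact: subset_closure.
  have [_ hx fx] := hn x.
  have /dvdnP [d mE] : (n x %| m)%N.
    by rewrite /m (big_rem x) //= dvdn_mulr.
  rewrite -yE; split=> [|w hw].
    rewrite mE natrM -mulrA; apply: ZhatM; first exact: Zhat_nat.
    rewrite mulrDr; apply: ZhatD => //.
    by do 2 (apply: ZhatM => //; first exact: Zhat_nat).
  rewrite fx // mulnC in mE *.
  rewrite mE natrM -mulrA -addrA -mulrDr fx //.
  by apply: ZhatD => //; apply: ZhatM => //; exact: Zhat_nat.
exists m => //; split=> [x /key []//|y w hw].
have [fy|fy] := eqVneq (f y) 0; last by case: (key y fy) => _ ->.
(* Where f vanishes [key] is silent; it is applied at the translated point, moving back by -w. *)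
have [fyw|/key [_ /(_ (- w))]] := eqVneq (f (y + m%:R * w)) 0.
  by rewrite fy fyw.
by rewrite mulrN addrK => <- //; exact: ZhatN.
Qed.

End BruhatSchwartzLevel.

(** * The additive character *)

Lemma frac_partP x : 0 <= frac_part x < 1 /\ Zhat (x - adele_of_rat (frac_part x)).
Proof.
rewrite /frac_part.
apply: (@xgetPex _ _ [set q : rat | 0 <= q < 1 /\ Zhat (x - adele_of_rat q)]).
have [d d0 hx] := adele_denominator x.
have [j [z [jd hz e]]] := Zhat_residue d0 hx.
exists (j%:R / d%:R); split.
  by rewrite divr_ge0 ?ler0n //= ltr_pdivrMr ?ltr0n // mul1r ltr_nat.
rewrite mulrC rmorphM rmorph_nat /= -[x](adele_natVM _ d0) -mulrBr e.
by rewrite [_%:R + _]addrC addrK adele_natVM.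
Qed.

Section CharacterTheory.
Variable R : realType.
Local Open Scope complex_scope.

Definition cis (t : R) : R[i] := cos (2 * pi * t) +i* sin (2 * pi * t).

Lemma cisD s t : cis (s + t) = cis s * cis t.
Proof.
rewrite /cis mulrDr cosD sinD; apply/eqP; rewrite eq_complex /= eqxx /=.
by rewrite [X in _ + X]mulrC addrC mulrC eqxx.
Qed.

Lemma cis0 : cis 0 = 1.
Proof. by rewrite /cis mulr0 cos0 sin0. Qed.

Lemma cis_int (n : int) : cis n%:~R = 1.
Proof.
have cisn (k : nat) : cis k%:R = 1.
  elim: k => [|k IH]; first exact: cis0.
  by rewrite -addn1 natrD cisD IH mul1r /cis mulr1 mulr_natl cos2pi sin2pi.
case: n => k; first exact: cisn.
by rewrite NegzE rmorphN -[LHS]mulr1 -(cisn k.+1) -cisD addNr cis0.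
Qed.

(** The real part gives 1 = 1 - 2 sin(pi t)^2, while the sine is positive strictly between 0 and
    pi. *)
Lemma cis_eq1 t : 0 <= t < 1 -> cis t = 1 -> t = 0.
Proof.
move=> /andP[t0 t1] /(congr1 (@complex.Re R)) /= h.
apply: contrapT => /eqP tn0; have {}t0 : 0 < t by rewrite lt_neqAle eq_sym tn0.
have p0 := pi_gt0 R.
have s0 : 0 < sin (pi * t).
  by apply: sin_gt0_pi; rewrite mulr_gt0 //= gtr_pMr.
move: h; rewrite -mulrA mulr_natl mulr2n cosD -!expr2 cos2sin2.
move: (sin (pi * t)) s0 => s s0 h.
have : 0 < s ^+ 2 by rewrite exprn_gt0.
by lra.
Qed.

Lemma chi_cis x : chi R x = cis (ratr (frac_part x)).
Proof.
rewrite /chi /cexp /cis.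
set t : R := ratr _.
have -> : 2 * pi%:C * 'i * t%:C = 0 +i* (2 * pi * t) :> R[i].
  apply/eqP; rewrite eq_complex /=.
  by apply/andP; split; apply/eqP; ring.
by rewrite /= expR0 mul1r.
Qed.

(** Two rationals congruent to x modulo Zhat differ by an integer, so any of them may replace the
    fractional part; additivity of chi then needs no carry. *)
Lemma chi_rat x q : Zhat (x - adele_of_rat q) -> chi R x = cis (ratr q).
Proof.
move=> hq; have [_ hf] := frac_partP x; rewrite chi_cis.
have := ZhatB hq hf; rewrite opprB addrC subrKA -rmorphB => /Zhat_ratP/intrP [n e].
rewrite -[frac_part x](subrK q) e rmorphD /= cisD ratr_int cis_int mul1r //.
Qed.

Lemma chiD x y : chi R (x + y) = chi R x * chi R y.
Proof.
have [_ hx] := frac_partP x; have [_ hy] := frac_partP y.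
rewrite [in RHS]chi_cis [in RHS]chi_cis -cisD -rmorphD; apply: chi_rat.
by rewrite rmorphD opprD addrACA; exact: ZhatD.
Qed.

(** That the kernel is no larger than Zhat is what makes the transform vanish outside (1/m)Zhat and
    isolates a single node in the orthogonality relation. *)
Lemma chi_eq1 x : chi R x = 1 <-> Zhat x.
Proof.
split=> [|hx]; last first.
  have /chi_rat -> : Zhat (x - adele_of_rat 0) by rewrite rmorph0 subr0.
  by rewrite rmorph0 cis0.
have [q01 hx] := frac_partP x; rewrite chi_cis => /cis_eq1.
have q01R : (0 <= ratr (frac_part x) :> R) && (ratr (frac_part x) < 1 :> R).
  by rewrite ler0q -(rmorph1 (@ratr R)) ltr_rat.
move=> /(_ q01R)/eqP; rewrite fmorph_eq0 => /eqP q0.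
by move: hx; rewrite q0 rmorph0 subr0.
Qed.

Lemma chi_Zhat x : Zhat x -> chi R x = 1.
Proof. by move/chi_eq1. Qed.

Lemma chiNM x : chi R (- x) * chi R x = 1.
Proof. by rewrite -chiD addNr chi_Zhat //; exact: Zhat0. Qed.

Lemma chi_neq0 x : chi R x != 0.
Proof. by apply/eqP => h; have /eqP := chiNM x; rewrite h mulr0 eq_sym oner_eq0. Qed.

Lemma norm_chi x : `|chi R x| = 1.
Proof. by rewrite chi_cis /cis normc_def /= cos2Dsin2 sqrtr1. Qed.

Lemma conj_chi x : ((chi R x)^*)%R = chi R (- x).
Proof.
apply: (mulIf (chi_neq0 x)).
by rewrite [RHS](chiNM x) mulrC -(normCK (chi R x)) norm_chi expr1n.
Qed.

Lemma chiMn x n : chi R (x *+ n) = chi R x ^+ n.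
Proof.
elim: n => [|n IH]; first by rewrite chi_Zhat //; exact: Zhat0.
by rewrite mulrS chiD IH exprS.
Qed.

End CharacterTheory.

(** * The Fourier transform at a fixed level *)

Section FourierLevel.
Variables (R : realType) (mu : {measure set adele_borel -> \bar R}).
Hypotheses (haar_mu : is_haar mu) (mu_Zhat : mu Zhat = 1%E).
Local Open Scope complex_scope.

(** * Representatives of (1/m)Zhat modulo m Zhat *)

Definition node (m j : nat) : adele := adele_of_rat m%:R^-1 * j%:R.

Lemma nodeD m i j : node m (i + j) = node m i + node m j.
Proof. by rewrite /node natrD mulrDr. Qed.

Lemma node_mul m j : (0 < m)%N -> node m (j * m) = j%:R.
Proof. by move=> m0; rewrite /node mulnC natrM adele_natVM. Qed.

Lemma nat_mul_node m j : (0 < m)%N -> m%:R * node m j = j%:R.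
Proof. exact: adele_natMV. Qed.

Lemma residue_inj n i j z w : (i < n)%N -> (j < n)%N -> Zhat z -> Zhat w ->
  i%:R + n%:R * z = j%:R + n%:R * w :> adele -> i = j.
Proof.
move=> ni nj hz hw e; have n0 : (0 < n)%N by exact: leq_ltn_trans ni.
have : Zhat (adele_of_rat ((i%:R - j%:R) / n%:R)).
  rewrite mulrC rmorphM rmorphB /= !rmorph_nat.
  have -> : i%:R - j%:R = n%:R * (w - z) :> adele.
    by rewrite mulrBr; apply/eqP; rewrite subr_eq addrAC eq_sym subr_eq addrC -e.
  by rewrite adele_natVM //; exact: ZhatB.
move/Zhat_ratP/intrP => [q {}e].
have {}e : (i : int) - (j : int) = q * n.
  apply: (@intr_inj rat); rewrite rmorphB rmorphM /= -e divfK //.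
  by rewrite pnatr_eq0 -lt0n.
have : ((i : int) = (j : int) %[mod n])%Z.
  by apply/eqP; rewrite eqz_mod_dvd e dvdz_mull.
by rewrite !modz_nat !modn_small // => -[].
Qed.

Lemma node_residue m x : (0 < m)%N -> Zhat (m%:R * x) ->
  exists j z, [/\ (j < m * m)%N, Zhat z & x = node m j + m%:R * z].
Proof.
move=> m0 hx; have mm0 : (0 < m * m)%N by rewrite muln_gt0 m0.
have [j [z [jm hz e]]] := Zhat_residue mm0 hx.
exists j, z; split=> //; apply: (adele_natI m0).
by rewrite mulrDr adele_natMV // e natrM mulrA.
Qed.

Lemma node_inj m i j z w : (i < m * m)%N -> (j < m * m)%N -> Zhat z -> Zhat w ->
  node m i + m%:R * z = node m j + m%:R * w -> i = j.
Proof.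
move=> im jm hz hw; have m0 : (0 < m)%N by case: m im {jm}.
move/(congr1 ( *%R m%:R)); rewrite !mulrDr !nat_mul_node // !mulrA -natrM.
exact: residue_inj.
Qed.

(** * Haar integral of functions of a given level *)

Lemma measure_coset x m : (0 < m)%N ->
  mu [set x + m%:R * z | z in Zhat] = (m%:R^-1)%:E.
Proof.
move=> m0; have [inv _ _] := haar_mu.
pose B j : set adele := [set j%:R + m%:R * z | z in Zhat].
pose L : set adele := [set 0 + m%:R * z | z in Zhat].
have mB (y : adele) : measurable ([set y + m%:R * z | z in Zhat] : set adele_borel).
  by apply: sub_sigma_algebra; exact: adele_open_coset.
have tr y : mu [set y + m%:R * z | z in Zhat] = mu L.
  rewrite -(inv y L); last exact: mB.
  congr (mu _); apply/seteqP; split=> [_ [z hz <-]|_ [_ [z hz <-] <-]].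
    by exists (m%:R * z) => //; exists z => //; rewrite add0r.
  by exists z => //; rewrite add0r.
(* Zhat is the disjoint union of m translates of m Zhat, all of the same mass. *)
have ZE : Zhat = \bigcup_(j in `I_m) B j.
  apply/seteqP; split=> [y /(Zhat_residue m0) [j [z [jm hz ->]]]|y [j _ [z hz <-]]].
    by exists j => //; exists z.
  by apply: ZhatD; [exact: Zhat_nat|apply: ZhatM => //; exact: Zhat_nat].
have tB : trivIset `I_m B.
  move=> i j /= im jm [y [[z hz <-] [w hw e]]].
  by apply/esym; exact: residue_inj e.
rewrite tr; move: mu_Zhat; rewrite ZE measure_fin_bigcup //; last first.
  by move=> i _; exact: mB.
rewrite -fsbig_ord (eq_bigr (fun=> mu L)); last by move=> i _; exact: tr.
case E : (mu L) => [r| |].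
- rewrite sumEFin sumr_const card_ord => -[/(congr1 (fun t => t / m%:R))] /=.
  by rewrite -[r *+ m]mulr_natr mulfK ?pnatr_eq0 -?lt0n // mul1r => ->.
- case: m m0 {mB tr ZE tB B L E} => // m _ h.
  have : (+oo <= \sum_(i < m.+1) (+oo : \bar R))%E.
    by rewrite big_ord_recl leeDl // sume_ge0.
  by rewrite h.
- by have : (0 <= mu L)%E by []; rewrite E.
Qed.

(** Writes g as a finite combination of indicators of cosets whose mass is known. *)
Lemma level_decomp (g : adele -> R) m x : (0 < m)%N -> level m g ->
  g x = \sum_(j < m * m)
    g (node m j) * \1_[set node m j + m%:R * z | z in Zhat] x.
Proof.
move=> m0 lg; have [gx0|/eqP gx0] := pselect (g x = 0).
  rewrite gx0 big1 // => j _; rewrite indicE.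
  case: (boolP (x \in _)) => [/set_mem [z hz e]|_]; last by rewrite mulr0.
  by move: gx0; rewrite -e lg.2 // => ->; rewrite mul0r.
have [i [z [im hz xE]]] := node_residue m0 (lg.1 x gx0).
rewrite (bigD1 (Ordinal im)) //= big1 ?addr0 => [|j ji].
  rewrite indicE mem_set ?mulr1; last by exists z.
  by rewrite xE lg.2.
rewrite indicE memNset ?mulr0 // => -[w hw e].
move/eqP: ji; apply; apply: val_inj => /=.
by apply: (node_inj (ltn_ord j) im hw hz); rewrite e.
Qed.

Lemma Rintegral_level (g : adele -> R) m : (0 < m)%N -> level m g ->
  \int[mu]_x g x = m%:R^-1 * \sum_(j < m * m) g (node m j).
Proof.
move=> m0 lg; rewrite /Rintegral.
pose A j : set adele_borel := [set node m j + m%:R * z | z in Zhat].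
have mA j : measurable (A j).
  by apply: sub_sigma_algebra; exact: adele_open_coset.
have muA j : mu (A j) = (m%:R^-1)%:E by exact: measure_coset.
have iA j : mu.-integrable setT (fun x => (\1_(A j) x)%:E).
  apply/integrableP; split.
    by apply/measurable_realfun.measurable_EFinP; exact: measurable_realfun.measurable_indic.
  under eq_integral => x _ do rewrite /= ger0_norm ?indicE ?ler0n // -indicE.
  by rewrite integral_indic // setIT muA ltry.
under eq_integral => x _ do
  rewrite (level_decomp x m0 lg) -sumEFin.
rewrite integral_sum //; last first.
  move=> j; rewrite (_ : (fun x => _) =
    (fun x => (g (node m j))%:E * (\1_(A j) x)%:E)%E); last exact/funext.
  by apply: integrableZl.
rewrite (eq_bigr (fun j : 'I_(m * m) => (g (node m j) * m%:R^-1)%:E)).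
  by rewrite sumEFin /= -mulr_suml mulrC.
move=> j _; under eq_integral do rewrite EFinM.
rewrite integralZl //; last exact: iA.
rewrite EFinM -(muA j); congr (_ * _)%E.
by have := integral_indic mu measurableT (mA j); rewrite setIT.
Qed.

Lemma Cintegral_level (g : adele -> R[i]) m : (0 < m)%N -> level m g ->
  Cintegral mu g = m%:R^-1 * \sum_(j < m * m) g (node m j).
Proof.
move=> m0 [sg ig]; rewrite /Cintegral.
rewrite !(@Rintegral_level _ m) //; first last.
- split=> [x|x y hy]; last by rewrite ig.
  by move=> h; apply: sg; apply: contraNneq h => ->.
- split=> [x|x y hy]; last by rewrite ig.
  by move=> h; apply: sg; apply: contraNneq h => ->.
have -> : (m%:R^-1 : R[i]) = (m%:R^-1)%:C by rewrite fmorphV rmorph_nat.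
rewrite -!raddf_sum; case: (\sum_(_ < _) g _) => a b /=.
by apply/eqP; rewrite eq_complex /= !mul0r subr0 addr0 !eqxx.
Qed.

(** * The transform as a finite sum *)

Lemma sum_periodic (V : zmodType) (h : nat -> V) t a :
  (forall j, h (j + t)%N = h j) -> \sum_(j < t) h (j + a)%N = \sum_(j < t) h j.
Proof.
move=> ht; elim: a => [|a IH]; first by apply: eq_bigr => j _; rewrite addn0.
rewrite -IH; apply: (@addrI _ (h a)).
(* The t + 1 consecutive terms from a on are split at either end; the two end terms agree by
   periodicity. *)
have <- : \sum_(j < t.+1) h (j + a)%N = h a + \sum_(j < t) h (j + a.+1)%N.
  rewrite big_ord_recl add0n; congr (_ + _); apply: eq_bigr => j _.
  by rewrite addnS.
by rewrite big_ord_recr /= addrC -[RHS]addrC addrC [(t + a)%N]addnC ht.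
Qed.

Lemma if_congr (T : Type) (b c : bool) (x y z : T) :
  b = c -> x = y -> (if b then x else z) = (if c then y else z).
Proof. by move=> -> ->. Qed.

(** Outside (1/m)Zhat the integrand need not have level m, so the sum over m^2 nodes does not
    compute the integral there; hence the test. *)
Definition level_fourier (m : nat) (f : adele -> R[i]) (xi : adele) : R[i] :=
  if `[< Zhat (m%:R * xi) >]
  then m%:R^-1 * \sum_(j < m * m) f (node m j) * chi R (xi * node m j)
  else 0.

Lemma level_mul_chi m f xi : Zhat (m%:R * xi) -> level m f ->
  level m (fun x => f x * chi R (xi * x)).
Proof.
move=> hxi [sf inf]; split=> [x|x y hy].
  by rewrite mulf_eq0 negb_or => /andP[/sf].
rewrite inf // mulrDr chiD [chi R (xi * (m%:R * y))]chi_Zhat ?mulr1 //.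
by rewrite mulrCA mulrA; exact: ZhatM.
Qed.

Lemma fourier_level m f xi : (0 < m)%N -> level m f ->
  fourier mu f xi = level_fourier m f xi.
Proof.
move=> m0 lf; rewrite /fourier /level_fourier; case: asboolP => hxi.
  by rewrite (Cintegral_level m0) //; exact: level_mul_chi.
(* With d a denominator of xi, the integrand has level m d, so the integral is still a finite
   sum. *)
have [d d0 hd] := adele_denominator xi.
set n := (m * d)%N; have n0 : (0 < n)%N by rewrite muln_gt0 m0.
have lg : level n (fun x => f x * chi R (xi * x)).
  apply: level_mul_chi; last by apply: level_dvd lf; exact: dvdn_mulr.
  by rewrite natrM -mulrA; apply: ZhatM => //; exact: Zhat_nat.
rewrite (Cintegral_level n0 lg).
pose h j := f (node n j) * chi R (xi * node n j).
(* Shifting the nodes by m n, i.e. x by m, keeps the sum but multiplies each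
   term by chi (m xi), which is not 1. *)
have hper j : h (j + n * n)%N = h j.
  rewrite /h nodeD node_mul // -[n%:R]mulr1; exact: lg.2 Zhat1.
have := sum_periodic (m * n) hper.
rewrite (eq_bigr (fun j : 'I_(n * n) => h j * chi R (m%:R * xi))); last first.
  move=> j _; rewrite /h nodeD node_mul // mulrDr chiD [m%:R * xi]mulrC mulrA.
  by rewrite -{1}[m%:R]mulr1 lf.2 //; exact: Zhat1.
rewrite -mulr_suml => /eqP; rewrite -subr_eq0 -[X in _ - X]mulr1 -mulrBr mulf_eq0.
rewrite subr_eq0 => /orP[/eqP -> |/eqP /chi_eq1 //]; by rewrite mulr0.
Qed.

(** The period of f bounds the support of the transform. Its support bound gives the period: m y
    times the node j/m is j y, where chi is trivial. *)
Lemma fourier_preserves_level m f : (0 < m)%N -> level m f ->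
  level m (fourier mu f).
Proof.
move=> m0 lf; split=> [x|x y hy]; rewrite !(fourier_level _ m0 lf).
  by rewrite /level_fourier; case: asboolP => //; rewrite eqxx.
have hmy : Zhat (m%:R * (m%:R * y)).
  by do 2 (apply: ZhatM => //; first exact: Zhat_nat).
have sameZhat : Zhat (m%:R * (x + m%:R * y)) <-> Zhat (m%:R * x).
  rewrite mulrDr; split=> h; last exact: ZhatD.
  by rewrite -(addrK (m%:R * (m%:R * y)) (m%:R * x)); exact: ZhatB.
have sameTerm j : f (node m j) * chi R ((x + m%:R * y) * node m j) =
    f (node m j) * chi R (x * node m j).
  have h : Zhat (m%:R * y * node m j).
    by rewrite mulrAC nat_mul_node //; apply: ZhatM => //; exact: Zhat_nat.
  by rewrite mulrDl chiD (chi_Zhat R h) mulr1.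
rewrite /level_fourier; apply: if_congr (asbool_equiv_eq sameZhat) _.
exact: (congr1 ( *%R m%:R^-1) (eq_bigr _ (fun j _ => sameTerm (val j)))).
Qed.

(** * Inversion and Parseval at a fixed level *)

Lemma sum_expr_unity (F : fieldType) (c : F) n : c ^+ n = 1 ->
  \sum_(k < n) c ^+ k = if c == 1 then n%:R else 0.
Proof.
move=> cn; case: eqVneq => [->|c1].
  by rewrite (eq_bigr (fun=> 1)) ?sumr_const ?card_ord // => k _; rewrite expr1n.
apply/eqP; have /eqP := subrX1 c n.
by rewrite cn subrr eq_sym mulf_eq0 subr_eq0 (negPf c1).
Qed.

Lemma fourier_fourier m f x : (0 < m)%N -> level m f ->
  fourier mu (fourier mu f) x = f (- x).
Proof.
move=> m0 lf; rewrite (fourier_level _ m0 (fourier_preserves_level m0 lf)).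
rewrite /level_fourier; case: asboolP => hx; last first.
  by rewrite (level_support lf) // mulrN => /ZhatNE.
have m_neq0 : (m%:R : R[i]) != 0 by rewrite pnatr_eq0 -lt0n.
have [i [z [im hz xE]]] : exists i z, [/\ (i < m * m)%N, Zhat z & - x = node m i + m%:R * z].
  by apply: node_residue => //; rewrite mulrN; exact: ZhatN.
(* As [node m k] is k/m, the power [c j ^+ k] is chi of (node m j + x) * node m k, so the sum over k
   is geometric. *)
pose c j := chi R (adele_of_rat m%:R^-1 * (node m j + x)).
have cm j : c j ^+ (m * m) = 1.
  rewrite /c -chiMn; apply: chi_Zhat.
  rewrite -[_ *+ (m * m)]mulr_natl natrM -mulrA adele_natMV // mulrDr.
  by rewrite nat_mul_node //; apply: ZhatD => //; exact: Zhat_nat.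
(* c j = 1 means that node m j + x lies in m Zhat, and node m i represents -x. *)
have ci (j : 'I_(m * m)) : (c j == 1) = (j == i :> nat).
  apply/eqP/eqP => [/chi_eq1 h|->].
    apply: (@node_inj m j i 0 (z + adele_of_rat m%:R^-1 * (node m j + x))) => //.
    - exact: Zhat0.
    - exact: ZhatD.
    by rewrite mulrDr adele_natMV // addrA -xE mulr0 addr0 [RHS]addrCA addNr addr0.
  apply: chi_Zhat; rewrite -[x]opprK xE opprD addNKr -mulrN adele_natVM //.
  exact: ZhatN.
(* After interchanging the sums, the inner one is m^2 for j = i and 0 otherwise, which cancels both
   factors 1/m. *)
transitivity (m%:R^-1 * (m%:R^-1 * \sum_(j < m * m) f (node m j) *
    \sum_(k < m * m) c j ^+ k)).
  congr (_ * _); rewrite mulr_sumr.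
  under [RHS]eq_bigr do rewrite mulr_sumr mulr_sumr.
  rewrite exchange_big /=; apply: eq_bigr => k _.
  rewrite (fourier_level _ m0 lf) /level_fourier asboolT; last first.
    by rewrite nat_mul_node //; exact: Zhat_nat.
  rewrite -mulrA mulr_suml mulr_sumr; apply: eq_bigr => j _.
  rewrite -(mulrA (f _)) -chiD; congr (_ * (_ * _)).
  rewrite -chiMn; congr (chi R _).
  by rewrite [x * _]mulrC -mulrDr -[RHS]mulr_natr; exact: mulrAC.
under eq_bigr => j _ do rewrite (sum_expr_unity (cm j)) ci.
rewrite (bigD1 (Ordinal im)) //= big1 => [|j ji]; last first.
  by rewrite ifN ?mulr0 //; apply: contra ji => /eqP e; apply/eqP/val_inj.
rewrite eqxx addr0 xE lf.2 // natrM; move: (f _) => u.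
by field.
Qed.

Lemma parseval_level m (f g : adele -> R[i]) : (0 < m)%N -> level m f -> level m g ->
  Cintegral mu (fun x => f x * ((g x)^*)%R) =
  Cintegral mu (fun xi => fourier mu f xi * ((fourier mu g xi)^*)%R).
Proof.
move=> m0; have lprod (u v : adele -> R[i]) :
    level m u -> level m v -> level m (fun x => u x * ((v x)^*)%R).
  move=> [su iu] [_ iv]; split=> [x|x y hy]; last by rewrite iu // iv.
  by rewrite mulf_eq0 negb_or => /andP[/su].
move=> lf lg; have lf' := fourier_preserves_level m0 lf.
have lg' := fourier_preserves_level m0 lg.
rewrite [LHS](Cintegral_level m0 (lprod _ _ lf lg)).
rewrite [RHS](Cintegral_level m0 (lprod _ _ lf' lg')).
congr (_ * _).
(* Inversion at the nodes. Once the sums are interchanged, the remaining sum over i is the conjugate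
   of the transform of g. *)
have fE (i : nat) : f (node m i) = m%:R^-1 *
    \sum_(k < m * m) fourier mu f (node m k) * chi R (- node m i * node m k).
  rewrite -[node m i]opprK -(fourier_fourier _ m0 lf) (fourier_level _ m0 lf') /level_fourier.
  rewrite asboolT ?opprK // mulrN; apply: ZhatN.
  by rewrite nat_mul_node //; exact: Zhat_nat.
under eq_bigr do rewrite fE -mulrA mulr_suml mulr_sumr.
rewrite exchange_big /=; apply: eq_bigr => k _.
rewrite (fourier_level _ m0 lg) /level_fourier asboolT; last first.
  by rewrite nat_mul_node //; exact: Zhat_nat.
rewrite rmorphM rmorph_sum fmorphV rmorph_nat !mulr_sumr; apply: eq_bigr => i _.
rewrite rmorphM /= conj_chi [RHS]mulrCA; congr (_ * _).
rewrite -(mulrA (fourier mu f _)); congr (_ * _).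
rewrite [LHS]mulrC; congr (_ * chi R _).
by rewrite mulNr [node m i * _]mulrC.
Qed.

(** * The transform and the reflection as linear operators *)

Lemma fourier_bruhat_schwartz (f : bruhat_schwartz R) :
  fourier mu f \in @bruhat_schwartz_pred R.
Proof.
have [m m0 lf] := bruhat_schwartz_level f.
exact: level_bruhat_schwartz m0 (fourier_preserves_level m0 lf).
Qed.

Definition fourier_bs (f : bruhat_schwartz R) : bruhat_schwartz R :=
  BruhatSchwartz (fourier_bruhat_schwartz f).

Lemma common_level (f g : bruhat_schwartz R) :
  exists m, [/\ (0 < m)%N, level m f & level m g].
Proof.
have [a a0 lf] := bruhat_schwartz_level f.
have [b b0 lg] := bruhat_schwartz_level g.
exists (a * b)%N; split; first by rewrite muln_gt0 a0.
  exact: level_dvd (dvdn_mulr _ (dvdnn _)) lf.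
exact: level_dvd (dvdn_mull _ (dvdnn _)) lg.
Qed.

Lemma bruhat_schwartz_eqP (f g : bruhat_schwartz R) : f =1 g -> f = g.
Proof. by move=> fg; apply: val_inj; apply/funext. Qed.

Lemma fourier_bs_linear : linear fourier_bs.
Proof.
move=> a f g; have [m [m0 lf lg]] := common_level f g.
have lh : level m (a *: f + g : bruhat_schwartz R).
  split=> [x|x y hy]; last first.
    by rewrite -[LHS]/(a * f (x + m%:R * y) + g (x + m%:R * y)) lf.2 // lg.2.
  rewrite -[X in X != 0]/(a * f x + g x) => h.
  have [fx|/lf.1//] := eqVneq (f x) 0.
  by apply: lg.1; apply: contraNneq h => ->; rewrite fx mulr0 addr0.
apply: bruhat_schwartz_eqP => x.
rewrite -[RHS]/(a * fourier mu f x + fourier mu g x).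
rewrite -[LHS]/(fourier mu (a *: f + g : bruhat_schwartz R) x).
rewrite (fourier_level _ m0 lf) (fourier_level _ m0 lg) (fourier_level _ m0 lh).
rewrite /level_fourier; case: ifP => _; last by rewrite mulr0 addr0.
rewrite mulrCA -mulrDr; congr (_ * _).
rewrite mulr_sumr -big_split; apply: eq_bigr => j _.
rewrite -[X in X * chi _ _ = _]/(a * f (node m j) + g (node m j)).
by rewrite mulrDl -(mulrA a).
Qed.

HB.instance Definition _ := GRing.isLinear.Build R[i]
  (bruhat_schwartz R) (bruhat_schwartz R) *:%R fourier_bs fourier_bs_linear.

Lemma level_reflection m (f : adele -> R[i]) :
  level m f -> level m (fun x => f (- x)).
Proof.
move=> [sf inf]; split=> [x /sf|x y hy]; first by rewrite mulrN => /ZhatNE.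
by rewrite opprD -mulrN inf //; exact: ZhatN.
Qed.

Lemma reflection_bruhat_schwartz (f : bruhat_schwartz R) :
  (fun x => f (- x)) \in @bruhat_schwartz_pred R.
Proof.
have [m m0 lf] := bruhat_schwartz_level f.
exact: level_bruhat_schwartz m0 (level_reflection lf).
Qed.

Definition reflection_bs (f : bruhat_schwartz R) : bruhat_schwartz R :=
  BruhatSchwartz (reflection_bruhat_schwartz f).

Lemma reflection_bs_linear : linear reflection_bs.
Proof. by move=> a f g; apply: bruhat_schwartz_eqP. Qed.

HB.instance Definition _ := GRing.isLinear.Build R[i]
  (bruhat_schwartz R) (bruhat_schwartz R) *:%R reflection_bs reflection_bs_linear.

Lemma reflection_bsK : involutive reflection_bs.
Proof. by move=> f; apply: bruhat_schwartz_eqP => x /=; rewrite opprK. Qed.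

Lemma fourier_bs_twice f : fourier_bs (fourier_bs f) = reflection_bs f.
Proof.
apply: bruhat_schwartz_eqP => x; have [m m0 lf] := bruhat_schwartz_level f.
exact: (fourier_fourier x m0 lf).
Qed.

(** Both sides are the threefold transform of f. *)
Lemma fourier_reflection_bs f :
  fourier_bs (reflection_bs f) = reflection_bs (fourier_bs f).
Proof. by rewrite -!fourier_bs_twice. Qed.

(** * Continuity for the inductive limit topology *)

Definition level_bounded (T : bruhat_schwartz R -> bruhat_schwartz R) :=
  forall m (f : bruhat_schwartz R) (e : R), (0 < m)%N -> level m f ->
    (forall x, `|f x| < e%:C) ->
    level m (T f) /\ forall x, `|T f x| <= m%:R * e%:C.

(** The constant m comes from m^2 terms of modulus below e, weighted by 1/m. *)
Lemma fourier_bs_bounded : level_bounded fourier_bs.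
Proof.
move=> m f e m0 lf fe; split; first exact: fourier_preserves_level.
move=> x; have e0 : 0 <= e%:C :> R[i] := ltW (le_lt_trans (normr_ge0 _) (fe 0)).
rewrite -[X in `|X|]/(fourier mu f x) (fourier_level _ m0 lf) /level_fourier.
case: ifP => _; last by rewrite normr0 mulr_ge0 ?ler0n.
rewrite normrM normfV normr_nat.
rewrite mulrC ler_pdivrMr ?ltr0n //.
apply: le_trans (ler_norm_sum _ _ _) _.
apply: (@le_trans _ _ (\sum_(j < m * m) e%:C)).
  by apply: ler_sum => j _; rewrite normrM norm_chi mulr1 ltW.
by rewrite sumr_const card_ord -[e%:C *+ _]mulr_natl natrM mulrAC.
Qed.

Lemma reflection_fourier_bs_bounded : level_bounded (reflection_bs \o fourier_bs).
Proof.
move=> m f e m0 lf fe; have [lF Fe] := fourier_bs_bounded m0 lf fe.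
by split=> [|x]; [exact: level_reflection lF|exact: Fe].
Qed.

Lemma level_bounded_continuous (T : {linear bruhat_schwartz R -> bruhat_schwartz R}) :
  level_bounded T -> continuous T.
Proof.
move=> bT f A [U [aU nU] UA].
exists [set g | U (T g)]; last by move=> g Ug; apply: UA; rewrite -linearB.
split=> [a b g h ab Ug Uh|l k lk]; first by rewrite /= linearD !linearZ; exact: aU.
(* The operator need not map D^l_k to itself, but both it and its image lie in D^{-n}_n; the
   neighbourhood condition on U is used on that larger space. *)
pose n := maxn `|l| `|k|; pose m := lcm_value n.
have m0 : (0 < m)%N by exact: lcm_value_gt0.
have [|e e0 He] := nU (- n%:Z) n%:Z; first by apply: (@le_trans _ _ 0); rewrite ?oppr_le0.
have m2 : 0 < (m%:R * 2 : R) by rewrite mulr_gt0 ?ltr0n.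
(* The 2 makes the final bound strict: m times this radius is e/2. *)
exists (e / (m%:R * 2)); first exact: divr_gt0.
move=> g lg ge; have lmg : level m g.
  by apply: level_space_level lg; rewrite leq_max leqnn ?orbT.
have [lT Te] := bT m g _ m0 lmg ge.
apply: He; first exact: level_spaceN.
move=> x; apply: le_lt_trans (Te x) _.
have -> : (m%:R : R[i]) = (m%:R)%:C by rewrite rmorph_nat.
rewrite -rmorphM ltcR /=.
have -> : m%:R * (e / (m%:R * 2)) = e / 2.
  by field; rewrite pnatr_eq0 -lt0n.
by rewrite ltr_pdivrMr ?ltr0n // ltr_pMr // ltr1n.
Qed.

End FourierLevel.

Theorem theorem4p8 (R : realType) (mu : {measure set adele_borel -> \bar R})
    (haar_mu : is_haar mu) (mu_Zhat : mu Zhat = 1%E) :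
  [/\ exists F G : {linear bruhat_schwartz R -> bruhat_schwartz R},
        [/\ forall f, F f = fourier mu f :> (adele -> R[i]),
            cancel F G, cancel G F, continuous F & continuous G],
      forall (f : bruhat_schwartz R) (x : adele),
        f x = Cintegral mu (fun xi => chi R (xi * x) * fourier mu f (- xi)) &
      forall f g : bruhat_schwartz R,
        Cintegral mu (fun x => f x * (g x)^*) =
        Cintegral mu (fun xi => fourier mu f xi * (fourier mu g xi)^*)].
Proof.
pose F := fourier_bs haar_mu mu_Zhat.
(* The reflection after F is a right inverse of F; this also carries the inversion formula. *)
have FRF f : F (reflection_bs (F f)) = f.
  by rewrite /F fourier_reflection_bs fourier_bs_twice reflection_bsK.
split.
- exists (F : {linear _ -> _}), (@reflection_bs R \o F : {linear _ -> _}); split=> //.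
  + by move=> f /=; rewrite /F fourier_bs_twice reflection_bsK.
  + exact: level_bounded_continuous (fourier_bs_bounded haar_mu mu_Zhat).
  + exact: level_bounded_continuous (reflection_fourier_bs_bounded haar_mu mu_Zhat).
(* Up to commutativity, the stated integral is F applied to the reflected transform of f. *)
- move=> f x; rewrite -[in LHS](FRF f).
  rewrite -[LHS]/(fourier mu (reflection_bs (F f)) x) /fourier; congr Cintegral.
  by apply/funext => xi; rewrite mulrC [x * xi]mulrC.
- move=> f g; have [m [m0 lf lg]] := common_level f g.
  exact: (parseval_level haar_mu mu_Zhat m0 lf lg).
Qed.
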